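(* Let $d\ge1$, $n\ge2$, $M>0$, and let $X_1,\dots,X_n$ be arbitrary points in $\mathbb{B}^d$. Let $\xi_1,\dots,\xi_n$ be independent random variables that are sub-Gaussian with parameter $\varsigma>0$, i.e. $\mathbb{E}[\exp(\lambda\xi_i)]\le\exp(\varsigma^2\lambda^2/2)$ for all $\lambda\in\mathbb{R}$. Then for every $0<\delta\le M$, \[ \mathcal{G}_n(\mathcal{F}_{\sigma}(M);\delta,\xi_{1:n}) \lesssim \frac{\varsigma\, \delta^{\frac{3}{d+3}} M^{\frac{d}{d+3}}}{\sqrt{n}} \sqrt{\log(nM/\delta)}, \] where the implied constant does not depend on $\xi_{1:n}$, on the points $X_{1:n}\in\mathbb{B}^d$, on $n$, $\delta$, $M$ or $\varsigma$. Moreover, for any constant $B>0$, the same bound holds with $\mathcal{F}_\sigma(M)$ replaced by $\mathrm{star}(\mathcal{T}_B\mathcal{F}_\sigma(M))$.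
   Context: $\sigma(t)=\max\{t,0\}$; $\mathbb{B}^d$ is the closed unit ball of $\mathbb{R}^d$ and $\mathbb{S}^d$ the unit sphere of $\mathbb{R}^{d+1}$. For a finite signed Borel measure $\mu$ on $\mathbb{S}^d$, $f_\mu(x)=\int_{\mathbb{S}^d}\sigma((x^\intercal,1)v)d\mu(v)$ for $x\in\mathbb{B}^d$; $\mathcal{F}_\sigma$ is the set of all such functions, $\gamma(f)=\inf\{|\mu|(\mathbb{S}^d):f=f_\mu\}$, and $\mathcal{F}_\sigma(M)=\{f\in\mathcal{F}_\sigma:\gamma(f)\le M\}$. For a class $\mathcal{F}$ of real functions on $\mathbb{B}^d$, points $X_{1:n}$ with empirical norm $\|f\|_{L^2(\mu_n)}^2=\frac1n\sum_{i=1}^nf(X_i)^2$, and independent zero-mean $\xi_{1:n}$, the local complexity is $\mathcal{G}_n(\mathcal{F};\delta,\xi_{1:n})=\mathbb{E}_{\xi_{1:n}}\big[\sup_{f\in\mathcal{F},\|f\|_{L^2(\mu_n)}\le\delta}|\frac1n\sum_{i=1}^n\xi_if(X_i)|\big]$. The truncation is $\mathcal{T}_Bf(x)=f(x)$ if $|f(x)|\le B$ and $\mathrm{sgn}(f(x))B$ otherwise, $\mathcal{T}_B\mathcal{F}=\{\mathcal{T}_Bf:f\in\mathcal{F}\}$, and $\mathrm{star}(\mathcal{F})=\{af:f\in\mathcal{F},a\in[0,1]\}$. $A\lesssim C$ means $A\le cC$ for a constant $c>0$ depending only on $d$ (and on $B$ for the truncated class). *)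

(* Defs.v *)
From HB Require Import structures.
From mathcomp Require Import all_boot all_order all_algebra.
From mathcomp Require Import all_classical all_reals all_analysis.
Set Implicit Arguments. Unset Strict Implicit. Unset Printing Implicit Defensive.
Import Order.TTheory GRing.Theory Num.Theory.
Import numFieldNormedType.Exports.
Local Open Scope classical_set_scope.
Local Open Scope ring_scope.

Section Defs.
Variable R : realType.

Definition relu (t : R) : R := Num.max t 0.

Definition unit_ball (d : nat) : set 'rV[R]_d :=
  [set x | \sum_(i < d) (x ord0 i) ^+ 2 <= 1].
Definition unit_sphere (d : nat) : set 'rV[R]_d.+1 :=
  [set v | \sum_(i < d.+1) (v ord0 i) ^+ 2 = 1].

Definition aug_dot (d : nat) (x : 'rV[R]_d) (v : 'rV[R]_d.+1) : R :=
  \sum_(i < d) x ord0 i * v ord0 (widen_ord (leqnSn d) i) + v ord0 ord_max.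

Local Notation borelRV d := (g_sigma_algebraType (@open 'rV[R]_d.+1)).

(** f_mu(x) = \int_{S^d} relu((x^T,1) v) dmu(v), for the finite signed Borel
    measure (charge) mu, computed with its Jordan decomposition mu = mu+ - mu-
    given by the Hahn decomposition h. *)
Definition f_mu (d : nat) (mu : {charge set borelRV d -> \bar R})
    (P N : set (borelRV d)) (h : hahn_decomposition mu P N) (x : 'rV[R]_d) : R :=
  fine (\int[jordan_pos h]_(v in (@unit_sphere d : set (borelRV d)))
          (relu (aug_dot x v))%:E)
  - fine (\int[jordan_neg h]_(v in (@unit_sphere d : set (borelRV d)))
          (relu (aug_dot x v))%:E).

Definition tv_sphere (d : nat) (mu : {charge set borelRV d -> \bar R})
    (P N : set (borelRV d)) (h : hahn_decomposition mu P N) : \bar R :=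
  charge_variation h (@unit_sphere d : set (borelRV d)).

(** F_sigma: functions of the form f_mu (only their values on B^d matter) *)
Definition F_sigma (d : nat) : set ('rV[R]_d -> R) :=
  [set f | exists (mu : {charge set borelRV d -> \bar R}) P N
             (h : hahn_decomposition mu P N),
             forall x, @unit_ball d x -> f x = f_mu h x].

Definition gamma (d : nat) (f : 'rV[R]_d -> R) : \bar R :=
  ereal_inf [set t : \bar R | exists (mu : {charge set borelRV d -> \bar R})
     (P N : set (borelRV d)) (h : hahn_decomposition mu P N),
     (forall x, @unit_ball d x -> f x = f_mu h x) /\ t = tv_sphere h].

Definition F_sigma_M (d : nat) (M : R) : set ('rV[R]_d -> R) :=
  [set f | @F_sigma d f /\ (@gamma d f <= M%:E)%E].

Definition truncB (B : R) (d : nat) (f : 'rV[R]_d -> R) : 'rV[R]_d -> R :=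
  fun x => if `|f x| <= B then f x else Num.sg (f x) * B.
Definition truncB_class (B : R) (d : nat) (F : set ('rV[R]_d -> R)) :=
  [set truncB B f | f in F].
Definition star_hull (d : nat) (F : set ('rV[R]_d -> R)) :=
  [set g | exists (a : R) (f : 'rV[R]_d -> R),
     0 <= a <= 1 /\ F f /\ g = (fun x => a * f x)].

Definition emp_norm (d n : nat) (X : 'I_n -> 'rV[R]_d) (f : 'rV[R]_d -> R) : R :=
  Num.sqrt (n%:R^-1 * \sum_(i < n) (f (X i)) ^+ 2).

Definition local_complexity (dm : measure_display) (Omega : measurableType dm)
    (Pr : probability Omega R) (d n : nat) (X : 'I_n -> 'rV[R]_d)
    (xi : 'I_n -> Omega -> R) (F : set ('rV[R]_d -> R)) (delta : R) : \bar R :=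
  (\int[Pr]_w ereal_sup
     [set (`| n%:R^-1 * \sum_(i < n) xi i w * f (X i) |)%:E
       | f in [set f | F f /\ (emp_norm X f <= delta)%R]])%E.

Definition mutually_independent (dm : measure_display) (Omega : measurableType dm)
    (Pr : probability Omega R) (n : nat) (xi : 'I_n -> Omega -> R) : Prop :=
  (forall i, measurable_fun setT (xi i)) /\
  forall B : 'I_n -> set R, (forall i, measurable (B i)) ->
    Pr (\bigcap_(i in [set: 'I_n]) (xi i @^-1` B i)) =
    (\prod_(i < n) Pr (xi i @^-1` B i))%E.

Definition sub_gaussian (dm : measure_display) (Omega : measurableType dm)
    (Pr : probability Omega R) (s : R) (xi : Omega -> R) : Prop :=
  forall l : R, (\int[Pr]_w (expR (l * xi w))%:E <= (expR (s ^+ 2 * l ^+ 2 / 2))%:E)%E.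

Definition theorem5_bound (C : R) (Fam : forall d : nat, R -> set ('rV[R]_d -> R))
    (d : nat) : Prop :=
  forall (n : nat) (M : R) (X : 'I_n -> 'rV[R]_d)
         (dm : measure_display) (Omega : measurableType dm)
         (Pr : probability Omega R) (xi : 'I_n -> Omega -> R) (s delta : R),
    (2 <= n)%N -> 0 < M -> (forall i, @unit_ball d (X i)) ->
    0 < s -> mutually_independent Pr xi -> (forall i, sub_gaussian Pr s (xi i)) ->
    0 < delta -> delta <= M ->
    (local_complexity Pr X xi (Fam d M) delta <=
     (C * s * delta `^ (3 / (d%:R + 3)) * M `^ (d%:R / (d%:R + 3))
        / Num.sqrt n%:R * Num.sqrt (ln (n%:R * M / delta)))%:E)%E.

End Defs.

(* Main.v *)
Require Import Defs.
From HB Require Import structures.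
From mathcomp Require Import all_boot all_order all_algebra.
From mathcomp Require Import all_classical all_reals all_analysis.
From mathcomp Require Import measurable_realfun ring lra zify.
Set Implicit Arguments. Unset Strict Implicit. Unset Printing Implicit Defensive.
Import Order.TTheory GRing.Theory Num.Theory.
Local Open Scope ring_scope.

(** Every f in F_sigma(M) is, up to a negligible error, a finite combination
    of ridge functions relu(q . (x,1)) with coefficients of total variation O(M).
    Draw r of the points X_i and partition the directions q by the signs of
    q . (X_i,1) on the sample, refined by a grid of mesh 1/r on the faces of a
    cube.  By Sauer's lemma there are O(r^d) classes, and by a leave-one-out
    argument (the weighted one-inclusion graph of a family of VC dimension d has
    edge density at most d) two directions of the same class are separated,
    on average, by only a fraction O(1/r) of the points.  Freezing the sign
    pattern on each class thus approximates relu with mean square error O(r^-3),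
    and Maurey's sampling of the residual by r^d terms improves this to
    M r^(-(d+3)/2) with O(r^d) parameters.  This gives the entropy bound
    log N(M r^(-(d+3)/2)) = O(r^d log r) in L^2(mu_n), uniformly in the points,
    and it survives composition with a contraction and star hulls.  Dudley's
    chaining for the sub-Gaussian process xi concludes. *)

(** * One-inclusion graphs and Sauer's lemma *)

(** The error r^-3 has two sources: two directions of a class disagree on a fraction O(1/r) of the
    points, and at those points the grid forces |q . (X_i,1)| = O(1/r), which is then squared. The
    dimension is d and not d + 1 because a face fixes the sign of one coordinate of q: up to scaling
    the directions lie in a piece of R^d, which d + 1 hyperplanes cannot cut into 2^(d+1) regions.
    The one-inclusion argument averages over directions, so the representing measure is first moved
    to finitely many nodes; their number is polynomial in the resolution and enters only through its
    logarithm. Taking r = rho^2 avoids half-integer powers: radius M rho^-(d+3), entropy rho^(2d)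
    log rho. The chaining sum then behaves like the sum of M rho^-3 over dyadic rho, dominated by
    the coarsest scale M rho^-(d+3) = delta, whence delta^(3/(d+3)) M^(d/(d+3)). The supremum over
    the class may fail to be measurable, so chaining produces measurable majorants with bounded
    integral instead of expected maxima. *)

Section OneInclusion.
Variable R : realType.
Implicit Types (m k : nat) (w : seq bool -> R).

Fixpoint cube_sum m w : R :=
  if m is m'.+1 then
    cube_sum m' (fun t => w (true :: t)) + cube_sum m' (fun t => w (false :: t))
  else w [::].

(** An edge of the cube weighs the smaller of the weights of its two ends. Recursion on the head bit
    suits the shifting argument. *)
Fixpoint edge_sum m w : R :=
  if m is m'.+1 then
    cube_sum m' (fun t => Num.min (w (true :: t)) (w (false :: t)))
    + (edge_sum m' (fun t => w (true :: t)) + edge_sum m' (fun t => w (false :: t)))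
  else 0.

(** The support of [w] has VC dimension less than [k]. Repeated coordinates are harmless: a
    contradictory pattern is then missed. *)
Definition unshattered k m w :=
  forall e : seq nat, size e = k -> all (fun i => i < m)%N e ->
  exists2 p : seq bool, size p = k &
    forall t, size t = m -> w t != 0 -> [seq nth false t i | i <- e] != p.

Lemma eq_cube_sum m w1 w2 : (forall t, size t = m -> w1 t = w2 t) ->
  cube_sum m w1 = cube_sum m w2.
Proof.
elim: m w1 w2 => [|m IH] w1 w2 e /=; first exact: e.
by congr (_ + _); apply: IH => t st; apply: e; rewrite /= st.
Qed.

Lemma ler_cube_sum m w1 w2 : (forall t, size t = m -> w1 t <= w2 t) ->
  cube_sum m w1 <= cube_sum m w2.
Proof.
elim: m w1 w2 => [|m IH] w1 w2 e /=; first exact: e.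
by apply: lerD; apply: IH => t st; apply: e; rewrite /= st.
Qed.

Lemma cube_sumD m w1 w2 :
  cube_sum m (fun t => w1 t + w2 t) = cube_sum m w1 + cube_sum m w2.
Proof. by elim: m w1 w2 => [//|m IH] w1 w2 /=; rewrite !IH addrACA. Qed.

Lemma cube_sumZ m (c : R) w : cube_sum m (fun t => c * w t) = c * cube_sum m w.
Proof. by elim: m w => [//|m IH] w /=; rewrite !IH mulrDr. Qed.

Lemma cube_sum0 m w : (forall t, size t = m -> w t = 0) -> cube_sum m w = 0.
Proof.
elim: m w => [|m IH] w e /=; first exact: e.
by rewrite !IH ?addr0// => t st; apply: e; rewrite /= st.
Qed.

Lemma cube_sum_exchange (I : finType) m (F : I -> seq bool -> R) :
  cube_sum m (fun t => \sum_i F i t) = \sum_i cube_sum m (F i).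
Proof. by elim: m F => [//|m IH] F /=; rewrite !IH big_split. Qed.

Lemma cube_sum_delta m s : cube_sum m (fun t => (t == s)%:R) = (size s == m)%:R.
Proof.
elim: m s => [|m IH] [|b s] //=.
  by rewrite !cube_sum0 ?addr0.
have E c : cube_sum m (fun t => (c :: t == b :: s)%:R) = (c == b)%:R * (size s == m)%:R.
  rewrite -IH; case: eqP => [->|ne]; rewrite ?mul1r ?mul0r.
    by apply: eq_cube_sum => t _; rewrite eqseq_cons eqxx.
  by apply: cube_sum0 => t _; rewrite eqseq_cons; case: eqP ne.
by rewrite !E eqSS; case: b {E}; rewrite /= ?mul1r ?mul0r ?addr0 ?add0r.
Qed.

Lemma edge_sum_max_min m w1 w2 :
  edge_sum m w1 + edge_sum m w2 <=
  edge_sum m (fun t => Num.max (w1 t) (w2 t)) + edge_sum m (fun t => Num.min (w1 t) (w2 t)).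
Proof.
elim: m w1 w2 => [|m IH] w1 w2 /=; first by rewrite !addr0.
rewrite [leLHS]addrACA [leRHS]addrACA; apply: lerD.
  rewrite -!cube_sumD; apply: ler_cube_sum => t _.
  move: (w1 _) (w2 _) (w1 _) (w2 _) => a b c d.
  (* The sum of two minima is their maximum plus their minimum. The latter is the least of the four
     weights on both sides, and a maximum of minima is at most the minimum of the maxima. *)
  rewrite -addr_max_min [X in _ <= _ + X]minACA lerD2r.
  by rewrite ge_max !le_min !le_max !ge_min !lexx ?orbT.
rewrite [leLHS]addrACA [leRHS]addrACA; apply: lerD; exact: IH.
Qed.

Lemma unshattered0 m w : unshattered 0 m w -> forall t, size t = m -> w t = 0.
Proof.
move=> /(_ [::] erefl isT) [[]//= _ H] t st.
by apply/eqP; apply: contraT => /(H _ st).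
Qed.

(** The support of the maximum lies in the projection of the support that forgets the head bit. *)
Lemma unshattered_max k m w : unshattered k m.+1 w ->
  unshattered k m (fun t => Num.max (w (true :: t)) (w (false :: t))).
Proof.
move=> H e se le.
have [||p sp Hp] := H [seq i.+1 | i <- e]; rewrite ?size_map// ?all_map//.
exists p => // t st; rewrite /Num.max; case: ifP => _ nz;
  have := Hp (_ :: t) _ nz; rewrite /= st -map_comp; exact.
Qed.

Lemma unshattered_min k m w : unshattered k.+1 m.+1 w -> (forall t, 0 <= w t) ->
  unshattered k m (fun t => Num.min (w (true :: t)) (w (false :: t))).
Proof.
move=> H w0 e se le.
have [||p sp Hp] := H (0%N :: [seq i.+1 | i <- e]).
- by rewrite /= size_map se.
- by rewrite /= all_map.
case: p sp Hp => // b p [sp] Hp; exists p => // t st nz.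
have nzb : w (b :: t) != 0.
  apply: contraNneq nz => wb.
  by apply/eqP; case: b wb {Hp} => wb; rewrite wb; [apply: min_l|apply: min_r]; rewrite w0.
by have := Hp _ _ nzb; rewrite /= st => /(_ erefl); rewrite eqseq_cons eqxx -map_comp.
Qed.

(* Haussler's shifting: replacing the two halves of the cube by their pointwise
   maximum and minimum can only increase the number of edges, and the minimum
   has smaller dimension. *)
Lemma edge_sum_le k m w : (forall t, 0 <= w t) -> unshattered k m w ->
  edge_sum m w <= k.-1%:R * cube_sum m w.
Proof.
elim: m k w => [|m IH] k w w0 H /=.
  by rewrite mulr_ge0// w0.
set w' := fun t => Num.max (w (true :: t)) (w (false :: t)).
set w'' := fun t => Num.min (w (true :: t)) (w (false :: t)).
have E : cube_sum m (fun t => w (true :: t)) + cube_sum m (fun t => w (false :: t)) =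
    cube_sum m w' + cube_sum m w''.
  by rewrite -!cube_sumD; apply: eq_cube_sum => t _; rewrite /w' /w'' addr_max_min.
have w'0 t : 0 <= w' t by rewrite le_max w0.
have w''0 t : 0 <= w'' t by rewrite le_min !w0.
rewrite E; apply: le_trans (lerD (lexx _) (edge_sum_max_min _ _ _)) _.
rewrite -/w' -/w''.
case: k H => [|k] H.
  have H0 := unshattered0 H.
  have Z1 t : size t = m -> w' t = 0 by move=> st; rewrite /w' !H0 ?maxxx //= st.
  have Z2 t : size t = m -> w'' t = 0 by move=> st; rewrite /w'' !H0 ?minxx //= st.
  rewrite mul0r -[0]addr0 (cube_sum0 Z2) add0r.
  have U f : (forall t, size t = m -> f t = 0) -> unshattered 0 m f.
    by move=> Hf e se _; exists [::] => // t /Hf ->; rewrite eqxx.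
  apply: lerD.
    by apply: le_trans (IH 0%N _ w'0 (U _ Z1)) _; rewrite mul0r.
  by apply: le_trans (IH 0%N _ w''0 (U _ Z2)) _; rewrite mul0r.
have H1 := IH _ _ w'0 (unshattered_max H).
have H2 := IH _ _ w''0 (unshattered_min H w0).
apply: le_trans (lerD (lexx _) (lerD H1 H2)) _ => /=.
(* The edges along the head bit weigh exactly the total of [w''], which makes up for its dimension
   being one less; for [k = 0] this total vanishes. *)
case: k {H1 H2} H => [|k] H /=.
  by rewrite (cube_sum0 (unshattered0 (unshattered_min H w0))); lra.
by rewrite -[k.+1%:R]natr1; lra.
Qed.

(** The maximum counts the tails that occur, the minimum those that occur with both head bits. The
    bound (m + 1)^k, in place of a binomial sum, closes by (m + 1)^(k+1) + (m + 1)^k <= (m +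
    2)^(k+1). *)
Lemma sauer k m w : (forall t, w t = 0 \/ w t = 1) -> unshattered k.+1 m w ->
  cube_sum m w <= (m.+1 ^ k)%N%:R.
Proof.
elim: m k w => [|m IH] k w w01 H /=.
  by rewrite exp1n; case: (w01 [::]) => ->.
set w' := fun t => Num.max (w (true :: t)) (w (false :: t)).
set w'' := fun t => Num.min (w (true :: t)) (w (false :: t)).
have E : cube_sum m (fun t => w (true :: t)) + cube_sum m (fun t => w (false :: t)) =
    cube_sum m w' + cube_sum m w''.
  by rewrite -!cube_sumD; apply: eq_cube_sum => t _; rewrite /w' /w'' addr_max_min.
have w0 t : 0 <= w t by case: (w01 t) => ->.
have w'01 t : w' t = 0 \/ w' t = 1 by rewrite /w' /Num.max; case: ifP.
have w''01 t : w'' t = 0 \/ w'' t = 1 by rewrite /w'' /Num.min; case: ifP.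
have H1 := IH _ _ w'01 (unshattered_max H).
rewrite E; case: k H H1 => [|k] H H1.
  by rewrite (cube_sum0 (unshattered0 (unshattered_min H w0))) addr0.
have H2 := IH _ _ w''01 (unshattered_min H w0).
apply: le_trans (lerD H1 H2) _.
rewrite -natrD ler_nat [(m.+2 ^ _)%N]expnS [(m.+1 ^ k.+1)%N]expnS.
have le : (m.+1 ^ k <= m.+2 ^ k)%N by case: k {H H1 H2} => // k; rewrite leq_exp2r.
nia.
Qed.

End OneInclusion.

(** * Leave-one-out partitions *)

Section LeaveOneOut.
Variables (R : realType) (V : finType) (T : Type) (ev : T -> V -> bool).
Implicit Types (nu : V -> R) (s : seq T) (p : seq bool) (x : T).

Definition pattern s v := [seq ev x v | x <- s].

Definition mass nu s p : R := \sum_v nu v * (pattern s v == p)%:R.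

Definition restrict nu x b : V -> R := fun v => nu v * (ev x v == b)%:R.

Lemma mass_cons nu x s b p : mass nu (x :: s) (b :: p) = mass (restrict nu x b) s p.
Proof.
by apply: eq_bigr => v _; rewrite /restrict /= eqseq_cons -mulrA -natrM mulnb.
Qed.

Lemma restrictC nu x b y c : restrict (restrict nu x b) y c = restrict (restrict nu y c) x b.
Proof. by apply: funext => v; rewrite /restrict mulrAC. Qed.

Lemma mass_ge0 nu s p : (forall v, 0 <= nu v) -> 0 <= mass nu s p.
Proof. by move=> nu0; apply: sumr_ge0 => v _; rewrite mulr_ge0. Qed.

Lemma cube_sum_mass nu s : cube_sum (size s) (mass nu s) = \sum_v nu v.
Proof.
rewrite /mass cube_sum_exchange; apply: eq_bigr => v _.
rewrite cube_sumZ -[RHS]mulr1; congr (_ * _).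
under [LHS]eq_cube_sum => t _ do rewrite eq_sym.
by rewrite cube_sum_delta size_map eqxx.
Qed.

Variables (n : nat) (pt : 'I_n -> T).

(** Expectation over [m] points drawn with replacement, left unnormalized: the total mass is n^m. *)
Fixpoint sample_sum m (F : seq T -> R) : R :=
  if m is m'.+1 then \sum_i sample_sum m' (fun s => F (pt i :: s)) else F [::].

Lemma eq_sample_sum m F G : (forall s, size s = m -> F s = G s) ->
  sample_sum m F = sample_sum m G.
Proof.
elim: m F G => [|m IH] F G e /=; first exact: e.
by apply: eq_bigr => i _; apply: IH => s ss; apply: e; rewrite /= ss.
Qed.

Lemma ler_sample_sum m F G : (forall s, size s = m -> F s <= G s) ->
  sample_sum m F <= sample_sum m G.
Proof.
elim: m F G => [|m IH] F G e /=; first exact: e.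
by apply: ler_sum => i _; apply: IH => s ss; apply: e; rewrite /= ss.
Qed.

Lemma sample_sumD m F G :
  sample_sum m (fun s => F s + G s) = sample_sum m F + sample_sum m G.
Proof.
by elim: m F G => [//|m IH] F G /=; rewrite -big_split; apply: eq_bigr => i _; rewrite IH.
Qed.

Lemma sample_sum_exchange (I : finType) m (F : I -> seq T -> R) :
  sample_sum m (fun s => \sum_i F i s) = \sum_i sample_sum m (F i).
Proof.
elim: m F => [//|m IH] F /=; rewrite exchange_big; apply: eq_bigr => i _.
exact: IH.
Qed.

Lemma sample_sum_cst m (c : R) : sample_sum m (fun=> c) = n%:R ^+ m * c.
Proof.
elim: m => [|m IH] /=; first by rewrite mul1r.
by rewrite IH sumr_const card_ord exprS -mulrA mulr_natl.
Qed.

Lemma sample_sum_exists m F (c : R) : sample_sum m F <= n%:R ^+ m * c -> (0 < n)%N ->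
  exists2 s, size s = m & F s <= c.
Proof.
move=> le n0; apply: contrapT => H.
have {}H s : size s = m -> c < F s.
  by move=> ss; rewrite ltNge; apply/negP => Fs; apply: H; exists s.
move: le; rewrite leNgt => /negP; apply; rewrite -sample_sum_cst.
elim: m F H => [|m IH] F H /=; first exact: H.
apply: ltr_sum => [|i _]; last by apply: IH => s ss; apply: H; rewrite /= ss.
by apply/hasP; exists (Ordinal n0); rewrite ?mem_index_enum.
Qed.

(** Weight of the edge above [p] along an extra coordinate for point [i]: the smaller of the two
    parts into which this point splits the class [p]. *)
Definition cut_mass nu i s p : R :=
  Num.min (mass (restrict nu (pt i) true) s p) (mass (restrict nu (pt i) false) s p).

(* By exchangeability, the edges of the one-inclusion graph of a sample of size
   m + 1 are equally distributed among its m + 1 coordinates. *)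
Lemma leave_one_out nu m :
  sample_sum m.+1 (fun s => edge_sum m.+1 (mass nu s)) =
  m.+1%:R * \sum_i sample_sum m (fun s => cube_sum m (cut_mass nu i s)).
Proof.
elim: m nu => [|m IH] nu.
  rewrite /= mul1r; apply: eq_bigr => i _; rewrite !addr0.
  by rewrite /cut_mass !mass_cons.
set A := \sum_i sample_sum m.+1 (fun s => cube_sum m.+1 (cut_mass nu i s)).
have -> : sample_sum m.+2 (fun s => edge_sum m.+2 (mass nu s)) =
    A + \sum_i \sum_b sample_sum m.+1
      (fun s => edge_sum m.+1 (mass (restrict nu (pt i) b) s)).
  rewrite /A -big_split; apply: eq_bigr => i _.
  rewrite -sample_sum_exchange; apply: etrans (sample_sumD _ _ _).
  rewrite -[LHS]/(sample_sum m.+1 (fun s => edge_sum m.+2 (mass nu (pt i :: s)))).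
  apply: eq_sample_sum => s ss.
  rewrite big_bool [edge_sum m.+2 _]/=.
  have E b : mass (restrict nu (pt i) b) s = (fun t => mass nu (pt i :: s) (b :: t)).
    by apply: funext => t; rewrite mass_cons.
  by rewrite /cut_mass !E.
under eq_bigr => i _ do under eq_bigr => b _ do rewrite IH.
(* The extra point and the first sampled point can be exchanged, since restrictions commute. *)
suff -> : A = \sum_i \sum_b \sum_j
    sample_sum m (fun s => cube_sum m (cut_mass (restrict nu (pt i) b) j s)).
  rewrite -[m.+2%:R]nat1r mulrDl mul1r; congr (_ + _); rewrite mulr_sumr.
  by apply: eq_bigr => i _; rewrite mulr_sumr.
rewrite /A /= exchange_big; apply: eq_bigr => i _; rewrite exchange_big.
apply: eq_bigr => j _; rewrite -sample_sum_exchange; apply: eq_sample_sum => s ss.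
by rewrite big_bool; congr (_ + _); apply: eq_cube_sum => t _;
  rewrite /cut_mass !mass_cons !(restrictC _ (pt j)).
Qed.

(** Averaging. The positive weight of the chosen [v] later places a representative inside its own
    class. *)
Lemma weighted_exists (eta f : V -> R) (c : R) : (forall v, 0 <= eta v) ->
  0 < \sum_v eta v -> \sum_v eta v * f v <= c * \sum_v eta v ->
  exists2 v, 0 < eta v & f v <= c.
Proof.
move=> eta0 pos le; apply: contrapT => H.
have {}H v : 0 < eta v -> c < f v.
  by move=> ev0; rewrite ltNge; apply/negP => fv; apply: H; exists v.
move: le; rewrite leNgt => /negP; apply.
have [v ev0] : exists v, 0 < eta v.
  apply: contrapT => N; move: pos; rewrite big1 ?ltxx// => v _; apply/eqP.
  by rewrite eq_le eta0 andbT leNgt; apply/negP => ev0; apply: N; exists v.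
rewrite mulr_sumr; rewrite (bigD1 v)//= [ltRHS](bigD1 v)//=.
apply: ltr_leD; first by rewrite mulrC ltr_pM2l// H.
apply: ler_sum => u _; rewrite mulrC; have := eta0 u.
rewrite le_eqVlt => /predU1P[<-|u0]; first by rewrite !mul0r.
by rewrite ler_pM2l// ltW// H.
Qed.

Variables (Phi : finType) (face : V -> Phi) (d : nat) (x0 : T).
Hypothesis faceP : forall f s, size s = d.+1 ->
  exists2 p, size p = d.+1 & forall v, face v = f -> pattern s v != p.

Lemma mass_unshattered nu f s : (forall v, face v != f -> nu v = 0) ->
  unshattered d.+1 (size s) (mass nu s).
Proof.
move=> nuf e se le.
have [|p sp Hp] := @faceP f [seq nth x0 s i | i <- e]; first by rewrite size_map.
exists p => // t st nz.
have [v] : exists v, nu v * (pattern s v == t)%:R != 0.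
  apply: contrapT => N; move/eqP: nz; apply; apply: big1 => v _.
  by apply/eqP/negPn/negP => h; apply: N; exists v.
rewrite mulf_eq0 negb_or pnatr_eq0 eqb0 negbK => /andP[nz' /eqP <-].
have fv : face v = f by apply/eqP; apply: contraNT nz' => /nuf ->.
apply: contraNneq (Hp v fv) => <-; apply/eqP.
rewrite /pattern -map_comp; apply/eq_in_map => i ie /=.
by rewrite (nth_map x0)//; move/allP: le; apply.
Qed.

Variables (grid : seq T) (r : nat).
(** The grid belongs to the class label, not to the random sample: the edge bound is applied within
    each label and the masses add up, so refining does not increase the disagreement. *)
Let key v := (face v, map_tuple (ev^~ v) (in_tuple grid)).
Let keyed nu g : V -> R := fun v => nu v * (key v == g)%:R.

(** On r + 1 points the edges weigh at most [d] times the mass, and by [leave_one_out] each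
    coordinate carries an equal share on average; some sample of size [r] does as well as the
    average. *)
Lemma exists_sample nu : (forall v, 0 <= nu v) -> (0 < n)%N ->
  exists2 s, size s = r & \sum_g \sum_i cube_sum r (cut_mass (keyed nu g) i s) <=
    n%:R * d%:R / r.+1%:R * \sum_v nu v.
Proof.
move=> nu0 n0; apply: sample_sum_exists => //.
rewrite sample_sum_exchange; under eq_bigr do rewrite sample_sum_exchange.
rewrite -(ler_pM2l (x := r.+1%:R)) ?ltr0n// mulr_sumr.
under eq_bigr do rewrite -leave_one_out.
have -> : r.+1%:R * (n%:R ^+ r * (n%:R * d%:R / r.+1%:R * \sum_v nu v)) =
    \sum_g sample_sum r.+1 (fun=> d%:R * \sum_v keyed nu g v).
  rewrite (eq_bigr _ (fun g _ => sample_sum_cst r.+1 _)).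
  rewrite -!mulr_sumr (exchange_big_dep predT)//= exprS.
  have -> : \sum_v \sum_i keyed nu i v = \sum_v nu v.
    apply: eq_bigr => v _; rewrite -mulr_sumr (bigD1 (key v))//= eqxx big1 ?addr0 ?mulr1//.
    by move=> g; rewrite eq_sym => /negPf ->.
  by field; rewrite addrC natr1 pnatr_eq0.
apply: ler_sum => g _; apply: ler_sample_sum => s ss.
rewrite -ss -(cube_sum_mass _ s); apply: (@edge_sum_le _ d.+1).
  by move=> t; apply: mass_ge0 => v; rewrite mulr_ge0.
apply: (@mass_unshattered _ g.1) => v ne; rewrite /keyed.
case: (key v =P g) => [E|_]; last by rewrite mulr0.
by rewrite -E eqxx in ne.
Qed.

Definition disagree u v : nat := \sum_i (ev (pt i) u != ev (pt i) v).

(** With both [u] and [v] weighted by [nu], the disagreement at a point is twice the product of the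
    two parts it cuts, hence at most twice the smaller part times the mass of the class. Averaging
    over [u] gives the representative. *)
Lemma exists_representative nu s p g v0 : (forall v, 0 <= nu v) ->
  key v0 = g -> pattern s v0 = p ->
  exists u, [/\ key u = g, pattern s u = p &
    \sum_v nu v * ((key v == g) && (pattern s v == p))%:R * (disagree u v)%:R <=
    2 * \sum_i cut_mass (keyed nu g) i s p].
Proof.
move=> nu0 k0 p0.
pose eta v := nu v * ((key v == g) && (pattern s v == p))%:R.
have eta0 v : 0 <= eta v by rewrite mulr_ge0.
pose m i b := \sum_v eta v * (ev (pt i) v == b)%:R.
have mE i b : mass (restrict (keyed nu g) (pt i) b) s p = m i b.
  apply: eq_bigr => v _; rewrite /restrict /keyed /eta -mulnb natrM -!mulrA.
  by congr (_ * (_ * _)); rewrite mulrC.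
have m0 i b : 0 <= m i b by apply: sumr_ge0 => v _; rewrite mulr_ge0.
have mD i : m i true + m i false = \sum_v eta v.
  rewrite -big_split; apply: eq_bigr => v _ /=; rewrite -mulrDr.
  by case: (ev _ _); rewrite /= ?addr0 ?add0r mulr1.
have cut i : cut_mass (keyed nu g) i s p = Num.min (m i true) (m i false).
  by rewrite /cut_mass !mE.
have [pos|] := ltP 0 (\sum_v eta v); last first.
  move=> le0; have Z v : eta v = 0.
    apply/eqP; rewrite eq_le eta0 andbT; apply: le_trans le0.
    by rewrite (bigD1 v)//= lerDl sumr_ge0.
  exists v0; split=> //; rewrite big1 => [|v _]; last by rewrite -/(eta v) Z mul0r.
  by rewrite mulr_ge0// sumr_ge0// => i _; rewrite cut le_min !m0.
have [|u u0 Hu] := @weighted_exists eta (fun u => \sum_v eta v * (disagree u v)%:R)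
    (2 * \sum_i cut_mass (keyed nu g) i s p) eta0 pos.
  have -> : \sum_u eta u * (\sum_v eta v * (disagree u v)%:R) =
      \sum_i 2 * (m i true * m i false).
    transitivity (\sum_u \sum_v \sum_i
        eta u * eta v * (ev (pt i) u != ev (pt i) v)%:R).
      apply: eq_bigr => u _; rewrite mulr_sumr; apply: eq_bigr => v _.
      by rewrite /disagree natr_sum mulrA mulr_sumr.
    rewrite pair_big_dep exchange_big; apply: eq_bigr => i _.
    rewrite -(pair_big_dep predT (fun _ => predT)
      (fun u v => eta u * eta v * (ev (pt i) u != ev (pt i) v)%:R)) /=.
    transitivity (m i true * m i false + m i false * m i true); last by ring.
    rewrite /m !mulr_suml -big_split; apply: eq_bigr => u _ /=.
    rewrite !mulr_sumr -big_split; apply: eq_bigr => v _ /=.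
    by case: (ev _ u); case: (ev _ v) => /=; ring.
  rewrite -mulr_sumr -mulrA; apply: ler_wpM2l => //; rewrite mulr_suml.
  apply: ler_sum => i _; rewrite cut -(mD i).
  move: (m0 i true) (m0 i false); move: (m i true) (m i false) => a b a0 b0.
  case: (lerP a b) => _; rewrite mulrDr.
    by rewrite lerDr mulr_ge0.
  by rewrite [b * a]mulrC lerDl mulr_ge0.
exists u; move: u0; rewrite /eta; case: eqP => [->|_]; last by rewrite mulr0 ltxx.
by case: eqP => [->|_]; last by rewrite mulr0 ltxx.
Qed.

(** Sauer's lemma on each face for the counting measure of [A]: by injectivity each pattern has
    weight 0 or 1. *)
Lemma card_representatives s (A : {set V}) :
  {in A &, forall u v, face u = face v -> pattern s u = pattern s v -> u = v} ->
  (#|A| <= #|Phi| * (size s).+1 ^ d)%N.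
Proof.
move=> inj; rewrite -(ler_nat R).
pose w f : seq bool -> R := fun t => mass (fun v => ((v \in A) && (face v == f))%:R) s t.
have -> : #|A|%:R = \sum_f cube_sum (size s) (w f).
  under eq_bigr do rewrite cube_sum_mass.
  rewrite exchange_big /= -sum1_card natr_sum big_mkcond; apply: eq_bigr => v _.
  case: (v \in A); last by rewrite big1.
  rewrite (bigD1 (face v))//= eqxx big1 ?addr0// => f; rewrite eq_sym.
  by move=> /negPf ->.
have -> : (#|Phi| * (size s).+1 ^ d)%:R = \sum_(f : Phi) ((size s).+1 ^ d)%N%:R :> R.
  by rewrite sumr_const natrM mulr_natl.
apply: ler_sum => f _; apply: sauer; last first.
  by apply: (@mass_unshattered _ f) => v /negPf ->; rewrite andbF.
move=> t; rewrite /w /mass.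
have [/existsP[v /andP[/andP[vA /eqP fv] /eqP pv]]|N] :=
    boolP [exists v, (v \in A) && (face v == f) && (pattern s v == t)].
  right; rewrite (bigD1 v)//= vA fv pv !eqxx mulr1 big1 ?addr0// => u uv.
  rewrite -natrM mulnb; apply/eqP; rewrite pnatr_eq0 eqb0; apply: contra uv.
  by move=> /andP[/andP[uA /eqP fu] /eqP pu]; apply/eqP/inj; rewrite ?fu ?pu ?pv.
left; rewrite big1// => u _; rewrite -natrM mulnb; apply/eqP.
rewrite pnatr_eq0 eqb0; apply: contra N => h; apply/existsP; exists u; exact: h.
Qed.

Lemma exists_partition nu : (forall v, 0 <= nu v) -> (0 < n)%N -> (0 < #|V|)%N ->
  exists c : V -> V, [/\ (#|[set c v | v in V]%SET| <= #|Phi| * (size grid + r).+1 ^ d)%N,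
    forall v, face (c v) = face v, forall v, pattern grid (c v) = pattern grid v &
    \sum_v nu v * (disagree (c v) v)%:R <= 2 * (n%:R * d%:R / r.+1%:R * \sum_v nu v)].
Proof.
move=> nu0 n0 /card_gt0P[v0 _].
have [s ss Hs] := exists_sample nu0 n0.
pose kl v := (key v, pattern s v).
have /choice[F HF] : forall k, exists u, (exists v, kl v = k) -> kl u = k /\
    \sum_v nu v * (kl v == k)%:R * (disagree u v)%:R <=
    2 * \sum_i cut_mass (keyed nu k.1) i s k.2.
  move=> k; have [[v kv]|N] := pselect (exists v, kl v = k); last by exists v0.
  have [u [ku pu Hu]] := exists_representative nu0 (congr1 fst kv) (congr1 snd kv).
  exists u => _; split; first by rewrite /kl ku pu; case: k {kv ku pu Hu}.
  by apply: le_trans Hu; rewrite le_eqVlt; apply/orP; left; apply/eqP; apply: eq_bigr => v' _.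
have Fkl v : kl (F (kl v)) = kl v by case: (HF (kl v)) => //; exists v.
have kface u v : kl u = kl v -> face u = face v
  by move=> /(congr1 (fun k => k.1.1)).
have kgrid u v : kl u = kl v -> pattern grid u = pattern grid v.
  by move=> /(congr1 (fun k => val k.1.2)).
exists (fun v => F (kl v)); split.
(* Grid and sample are concatenated, so one use of Sauer's lemma with exponent [d] counts all
   classes. *)
- rewrite -ss -size_cat; apply: card_representatives.
  move=> _ _ /imsetP[u _ ->] /imsetP[v _ ->].
  move=> f; rewrite /pattern !map_cat => /eqP.
  rewrite eqseq_cat ?size_map// => /andP[/eqP g /eqP p].
  have E : kl (F (kl u)) = kl (F (kl v)).
    congr (_, _); last exact: p.
    by rewrite /key f; congr (_, _); apply: val_inj.
  by move: E; rewrite !Fkl => ->.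
- by move=> v; apply: kface.
- by move=> v; apply: kgrid.
apply: (@le_trans _ _ (2 * \sum_g \sum_i cube_sum r (cut_mass (keyed nu g) i s))); last first.
  by apply: ler_wpM2l.
under [X in _ <= 2 * X]eq_bigr do rewrite -cube_sum_exchange.
pose P g p := 2 * \sum_i cut_mass (keyed nu g) i s p.
have P0 g p : 0 <= P g p.
  rewrite mulr_ge0// sumr_ge0// => i _.
  by rewrite le_min !mass_ge0// => v; rewrite /restrict /keyed !mulr_ge0.
have -> : \sum_v nu v * (disagree (F (kl v)) v)%:R =
   \sum_g cube_sum r (fun p => \sum_v nu v * (kl v == (g, p))%:R * (disagree (F (g, p)) v)%:R).
  under [RHS]eq_bigr do rewrite cube_sum_exchange.
  rewrite [RHS]exchange_big; apply: eq_bigr => v _ /=.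
  rewrite (bigD1 (key v))//= [X in _ + X]big1 ?addr0 => [|g gv]; last first.
    apply: cube_sum0 => p _; rewrite xpair_eqE eq_sym (negPf gv) /=.
    by rewrite mulr0 mul0r.
  transitivity (nu v * (disagree (F (kl v)) v)%:R *
      cube_sum r (fun p => (p == pattern s v)%:R)).
    by rewrite cube_sum_delta size_map ss eqxx mulr1.
  rewrite -cube_sumZ; apply: eq_cube_sum => p _; rewrite xpair_eqE eqxx /=.
  rewrite [p == _]eq_sym; case: eqP => [<-|_]; last by rewrite !mulr0 mul0r.
  by rewrite !mulr1.
rewrite mulr_sumr; apply: ler_sum => g _.
rewrite -cube_sumZ; apply: ler_cube_sum => p _.
have [ex|N] := pselect (exists v, kl v = (g, p)); first by case: (HF _ ex).
rewrite big1 ?P0// => v _; case: eqP => [h|_]; last by rewrite mulr0 mul0r.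
by case: N; exists v.
Qed.

End LeaveOneOut.

(** * Freezing the sign pattern of a ridge function *)

Section HalfspacePatterns.
Variables (R : realType) (d : nat).
Implicit Types (y q : 'I_d.+1 -> R).

Definition dot y q : R := \sum_k y k * q k.

(** Without coordinate [k] the d + 1 points live in dimension [d] and satisfy a linear relation; on
    the full points it leaves a multiple of q_k. The relation is oriented to make this multiple
    nonpositive or, if it is zero, to have a positive coefficient. *)
Lemma dot_face (s : seq ('I_d.+1 -> R)) (k : 'I_d.+1) (b : bool) : size s = d.+1 ->
  exists (lam : 'I_d.+1 -> R) (theta : R),
    [/\ forall q, 0 < (-1) ^+ b * q k ->
          \sum_i lam i * dot (nth (fun=> 0) s i) q = theta * ((-1) ^+ b * q k),
        theta <= 0 & theta < 0 \/ exists i, 0 < lam i].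
Proof.
move=> ss.
pose A : 'M[R]_(d.+1, d) := \matrix_(i, j) (nth (fun=> 0) s i) (lift k j).
have nz : kermx A != 0.
  rewrite -mxrank_eq0 mxrank_ker -lt0n subn_gt0.
  exact: leq_ltn_trans (rank_leq_col A) (ltnSn d).
have [i0 [j0 nzij]] : exists i j, kermx A i j != 0.
  by apply/matrix0Pn.
pose mu i := kermx A i0 i.
have mu0 j : \sum_i mu i * nth (fun=> 0) s i (lift k j) = 0.
  have /matrixP/(_ i0 j) := mulmx_ker A; rewrite mxE [RHS]mxE => E.
  by rewrite -[RHS]E; apply: eq_bigr => i _; rewrite [A i j]mxE.
pose kappa := \sum_i mu i * nth (fun=> 0) s i k.
have E q : \sum_i mu i * dot (nth (fun=> 0) s i) q = kappa * q k.
  rewrite /dot; under eq_bigr do rewrite (bigD1_ord k)//= mulrDr mulrA mulr_sumr.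
  rewrite big_split /= -mulr_suml exchange_big [X in _ + X]big1 ?addr0// => j _.
  under eq_bigr do rewrite mulrA.
  by rewrite -mulr_suml mu0 mul0r.
have sg2 : (-1) ^+ b * (-1) ^+ b = 1 :> R by rewrite -expr2 sqrr_sign.
pose theta := kappa * (-1) ^+ b.
have Et q : kappa * q k = theta * ((-1) ^+ b * q k).
  by rewrite /theta mulrA -(mulrA kappa) sg2 mulr1.
have flip q : \sum_i (- mu i) * dot (nth (fun=> 0) s i) q = - theta * ((-1) ^+ b * q k).
  under eq_bigr do rewrite mulNr.
  by rewrite sumrN E Et mulNr.
have [tn|tp|t0] := ltgtP theta 0.
- exists mu, theta; split; [by move=> q _; rewrite E Et|exact: ltW|by left].
- by exists (fun i => - mu i), (- theta); split=> [q _||]; rewrite ?flip ?oppr_le0 ?oppr_lt0 ?(ltW)//; left.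
have [mn|mp|/eqP] := ltgtP (mu j0) 0; last by rewrite (negPf nzij).
- exists (fun i => - mu i), (- theta); split=> [q _||]; rewrite ?flip// ?t0 ?oppr0//.
  by right; exists j0; rewrite oppr_gt0.
- exists mu, theta; split; [by move=> q _; rewrite E Et|by rewrite t0|by right; exists j0].
Qed.

(** The missed pattern is the sign vector of the relation of [dot_face]: a [q] realizing it makes
    all terms nonnegative, against a negative sum, and one term positive when the sum is zero. *)
Lemma halfspaces_unshattered (s : seq ('I_d.+1 -> R)) (k : 'I_d.+1) (b : bool) :
  size s = d.+1 ->
  exists2 p : seq bool, size p = d.+1 &
    forall q, 0 < (-1) ^+ b * q k -> [seq 0 < dot y q | y <- s] != p.
Proof.
move=> ss; have [lam [theta [E t0 H]]] := dot_face k b ss.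
exists [seq 0 < lam i | i <- enum 'I_d.+1]; first by rewrite size_map size_enum_ord.
move=> q q0; apply/eqP => P.
have {}P (i : 'I_d.+1) : (0 < dot (nth (fun=> 0) s i) q) = (0 < lam i).
  move: P => /(congr1 (fun t => nth false t i)).
  rewrite (nth_map (fun=> 0)) ?ss// => ->.
  by rewrite (nth_map ord0) ?size_enum_ord// nth_ord_enum.
have T i : 0 <= lam i * dot (nth (fun=> 0) s i) q.
  have := P i; have [l0|l0] := ltP 0 (lam i) => h.
    by apply: mulr_ge0; apply: ltW.
  by apply: mulr_le0 => //; rewrite leNgt h.
have S0 : 0 <= \sum_i lam i * dot (nth (fun=> 0) s i) q by apply: sumr_ge0.
case: H => [tn|[i li]].
  by move: S0; rewrite (E _ q0) leNgt nmulr_rlt0 ?q0.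
have : 0 < \sum_i lam i * dot (nth (fun=> 0) s i) q.
  rewrite (bigD1 i)//=; apply: ltr_wpDr; first exact: sumr_ge0.
  by apply: mulr_gt0 => //; rewrite P.
by rewrite (E _ q0) ltNge mulr_le0_ge0// ltW.
Qed.

End HalfspacePatterns.

(** * Cells of directions: faces, grid and sample signs *)

Section ReluPartition.
Variables (R : realType) (d : nat) (V : finType) (q : V -> 'I_d.+1 -> R).
Hypothesis q_neq0 : forall v k, q v k != 0.
Hypothesis q_le2 : forall v k, `|q v k| <= 2.
Variable r : nat.
Hypothesis r_gt0 : (0 < r)%N.

Definition main_coord v : 'I_d.+1 := [arg max_(k > ord0) `|q v k|]%O.
Definition cube_face v := (main_coord v, q v (main_coord v) < 0).

Lemma main_coordP v k : `|q v k| <= `|q v (main_coord v)|.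
Proof. by rewrite /main_coord; case: Order.TotalTheory.arg_maxP => // i _; apply. Qed.

Definition level (l : 'I_(2 * r).+1) : R := l%:R / r%:R - 1.

(** The mesh is encoded by fictitious points: on a face, comparing q_j/|q_k| with a level is a
    homogeneous halfspace test, so Sauer's lemma treats grid and sample alike. *)
Definition threshold (t : 'I_d.+1 * ('I_d.+1 * bool) * 'I_(2 * r).+1) : 'I_d.+1 -> R :=
  fun k => (k == t.1.1)%:R - level t.2 * ((-1) ^+ t.1.2.2 * (k == t.1.2.1)%:R).

Definition thresholds := [seq threshold t | t <- enum {: 'I_d.+1 * ('I_d.+1 * bool) * 'I_(2 * r).+1}].

Definition pos_side (y : 'I_d.+1 -> R) v := 0 < dot y (q v).

Lemma dot_threshold j k b l x :
  dot (threshold (j, (k, b), l)) x = x j - level l * ((-1) ^+ b * x k).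
Proof.
rewrite /dot /threshold /=; under eq_bigr do rewrite mulrBl.
rewrite sumrB (bigD1 j)//= eqxx mul1r big1 ?addr0; last by move=> i /negPf ->; rewrite mul0r.
rewrite (bigD1 k)//= eqxx mulr1 mulrA big1 ?addr0// => i /negPf ->.
by rewrite !(mulr0,mul0r).
Qed.

Lemma main_coord_sign v : (-1) ^+ (q v (main_coord v) < 0)%R * q v (main_coord v) =
  `|q v (main_coord v)|.
Proof. by rewrite mulr_sign; case: ltP => h; [rewrite ltr0_norm|rewrite ger0_norm]. Qed.

Lemma main_coord_gt0 v : 0 < `|q v (main_coord v)|.
Proof. by rewrite normr_gt0. Qed.

Lemma same_cell_close u v j : cube_face u = cube_face v ->
  pattern pos_side thresholds u = pattern pos_side thresholds v ->
  `|q u j / `|q u (main_coord u)| - q v j / `|q v (main_coord v)| | <= r%:R^-1.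
Proof.
move=> f p.
have r0 : 0 < r%:R :> R by rewrite ltr0n.
have side l w : cube_face w = cube_face v ->
    pos_side (threshold (j, cube_face v, l)) w = (level l < q w j / `|q w (main_coord w)|).
  move=> <-; rewrite /pos_side dot_threshold main_coord_sign subr_gt0.
  by rewrite ltr_pdivlMr// main_coord_gt0.
have same l : pos_side (threshold (j, cube_face v, l)) u = pos_side (threshold (j, cube_face v, l)) v.
  move: p; rewrite /pattern /thresholds -!map_comp => /eq_in_map /(_ (j, cube_face v, l)).
  by rewrite -enumT mem_enum => /(_ isT).
have {}same l : (level l < q u j / `|q u (main_coord u)|) = (level l < q v j / `|q v (main_coord v)|).
  by rewrite -side// same side.
have le1 w : -1 <= q w j / `|q w (main_coord w)| <= 1.
  rewrite -ler_norml normrM normfV normr_id ler_pdivrMr ?main_coord_gt0//.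
  by rewrite mul1r main_coordP.
have key a b : -1 <= a <= 1 -> -1 <= b <= 1 ->
    (forall l, (level l < a) = (level l < b)) -> a - b <= r%:R^-1.
  move=> /andP[a1 a2] /andP[b1 b2] H; rewrite leNgt; apply/negP => lt.
  (* The first level above [b] is at most b + 1/r, so it would separate [a] from [b]. *)
  have z0 : 0 <= r%:R * (b + 1) by rewrite mulr_ge0//; lra.
  have /andP[t1 t2] := truncn_itv z0.
  set m := Num.truncn _ in t1 t2.
  have lm : m.+1%:R / r%:R - 1 < a.
    apply: le_lt_trans (_ : b + r%:R^-1 < a); last by lra.
    rewrite lerBlDr ler_pdivrMr// -[m.+1%:R]natr1 2!mulrDl mulVf ?lt0r_neq0//.
    by move: t1; rewrite mulrDr !mulr1 [b * _]mulrC; lra.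
  have lb : b < m.+1%:R / r%:R - 1 by rewrite ltrBrDr ltr_pdivlMr// mulrC.
  have m2 : (m.+1 < (2 * r).+1)%N.
    rewrite ltnS -(ler_nat R) natrM -ler_pdivrMr//; lra.
  have := H (Ordinal m2); rewrite /level /= lm => /esym; lra.
rewrite ler_norml; apply/andP; split; last exact: key.
by rewrite lerNl opprB; apply: key => // l; rewrite same.
Qed.

(** When [y] separates [u] from [v], zero lies between two normalized products at distance at most
    (d + 1)/r; the factor 2 undoes the normalization. *)
Lemma same_cell_dot u v y : cube_face u = cube_face v ->
  pattern pos_side thresholds u = pattern pos_side thresholds v ->
  (forall k, `|y k| <= 1) -> pos_side y u != pos_side y v ->
  `|dot y (q v)| <= 2 * d.+1%:R / r%:R.
Proof.
move=> f p y1 ne.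
pose a w := dot y (q w) / `|q w (main_coord w)|.
have sgn w : pos_side y w = (0 < a w).
  by rewrite /pos_side pmulr_lgt0// invr_gt0 main_coord_gt0.
have close : `|a u - a v| <= d.+1%:R / r%:R.
  rewrite /a /dot !mulr_suml -sumrB; apply: le_trans (ler_norm_sum _ _ _) _.
  rewrite mulr_natl -[X in _ *+ X]card_ord -sumr_const; apply: ler_sum => k _.
  rewrite -!mulrA -mulrBr normrM -[leRHS]mul1r; apply: ler_pM => //.
  exact: same_cell_close.
have av : `|a v| <= d.+1%:R / r%:R.
  apply: le_trans close; move: ne; rewrite !sgn.
  by have [?|?] := ltP 0 (a u); have [?|?] := ltP 0 (a v) => // _;
    rewrite ler_norml; case: (ler0P (a u - a v)) => ?; apply/andP; split; lra.
have -> : dot y (q v) = a v * `|q v (main_coord v)|.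
  by rewrite /a mulfVK// lt0r_neq0// main_coord_gt0.
by rewrite normrM normr_id -[leRHS]mulrA [leRHS]mulrC; apply: ler_pM.
Qed.

(** The ridge function of [v] with its activation frozen to that of [u]. It is linear in [q v], so a
    whole class sums to d + 1 coefficients. *)
Definition gated_dot u v y : R := dot y (q v) * (pos_side y u)%:R.

Lemma relu_gated_dot u v y : cube_face u = cube_face v ->
  pattern pos_side thresholds u = pattern pos_side thresholds v ->
  (forall k, `|y k| <= 1) ->
  (relu (dot y (q v)) - gated_dot u v y) ^+ 2 <=
  (2 * d.+1%:R / r%:R) ^+ 2 * (pos_side y u != pos_side y v)%:R.
Proof.
move=> f p y1.
have := same_cell_dot f p y1; rewrite /gated_dot.
have -> : relu (dot y (q v)) = dot y (q v) * (pos_side y v)%:R.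
  by rewrite /relu /pos_side; case: ltP => h; rewrite ?mulr1 ?mulr0.
rewrite -mulrBr exprMn.
case: (pos_side y u); case: (pos_side y v); rewrite /= ?mulr0 ?subrr ?expr0n ?mulr0//.
- move=> /(_ isT) h; rewrite sub0r sqrrN expr1n !mulr1 -[leLHS]real_normK ?num_real//.
  by rewrite ler_sqr// nnegrE mulr_ge0.
- move=> /(_ isT) h; rewrite subr0 expr1n !mulr1 -[leLHS]real_normK ?num_real//.
  by rewrite ler_sqr// nnegrE mulr_ge0.
Qed.

Definition num_cells := (d.+1 * 2 * (d.+1 * (d.+1 * 2) * (2 * r).+1 + r).+1 ^ d)%N.

(** The squared bound (2(d + 1)/r)^2 of [same_cell_dot] times the disagreement fraction 2d/(r + 1)
    of [exists_partition]. *)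
Lemma relu_partition n (y : 'I_n -> 'I_d.+1 -> R) (nu : V -> R) :
  (0 < n)%N -> (0 < #|V|)%N -> (forall i k, `|y i k| <= 1) -> (forall v, 0 <= nu v) ->
  exists2 c : V -> V, (#|[set c v | v in V]%SET| <= num_cells)%N &
  \sum_v nu v * (\sum_i (relu (dot (y i) (q v)) - gated_dot (c v) v (y i)) ^+ 2) <=
  n%:R * (8 * d.+1%:R ^+ 3 / r%:R ^+ 3) * \sum_v nu v.
Proof.
move=> n0 V0 y1 nu0.
have [|//|//|//|c [cc cf cp H]] := @exists_partition R V _ pos_side n y _ cube_face d (fun=> 0) _ thresholds r nu.
  move=> [k b] s ss; have [p sp Hp] := halfspaces_unshattered k b ss.
  exists p => // v [kv bv]; apply: Hp.
  by rewrite -kv -bv main_coord_sign main_coord_gt0.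
exists c.
  move: cc; rewrite size_map -cardE !card_prod !card_ord card_bool.
  exact.
apply: (@le_trans _ _ ((2 * d.+1%:R / r%:R) ^+ 2 *
    \sum_v nu v * (disagree pos_side y (c v) v)%:R)).
  rewrite mulr_sumr; apply: ler_sum => v _; rewrite mulrCA; apply: ler_wpM2l => //.
  rewrite /disagree natr_sum mulr_sumr; apply: ler_sum => i _.
  exact: relu_gated_dot.
apply: le_trans (ler_wpM2l (sqr_ge0 _) H) _.
have S0 : 0 <= \sum_v nu v by apply: sumr_ge0.
have r0 : 0 < r%:R :> R by rewrite ltr0n.
have -> : (2 * d.+1%:R / r%:R) ^+ 2 * (2 * (n%:R * d%:R / r.+1%:R * \sum_v nu v)) =
  n%:R * (\sum_v nu v) * (8 * d.+1%:R ^+ 2 / r%:R ^+ 2) * (d%:R / r.+1%:R).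
  have : r.+1%:R != 0 :> R by rewrite pnatr_eq0.
  move: (\sum_v nu v) r.+1%:R d.+1%:R n%:R (d%:R : R) => S x D N E x0.
  by field; rewrite x0 lt0r_neq0.
have -> : n%:R * (8 * d.+1%:R ^+ 3 / r%:R ^+ 3) * \sum_v nu v =
  n%:R * (\sum_v nu v) * (8 * d.+1%:R ^+ 2 / r%:R ^+ 2) * (d.+1%:R / r%:R).
  by field; rewrite lt0r_neq0.
apply: ler_wpM2l; first by rewrite !(mulr_ge0, divr_ge0, exprn_ge0).
apply: ler_pM => //; rewrite ?ler_nat// ?invr_ge0// lef_pV2 ?posrE ?ltr0n// ler_nat.
exact: leqnSn.
Qed.

End ReluPartition.

(** * Maurey sampling and covers *)

Section Maurey.
Variables (R : realType) (V : finType) (n : nat) (nu : V -> R) (z : V -> 'I_n -> R).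
Hypothesis nu_ge0 : forall v, 0 <= nu v.
Hypothesis nu_sum1 : \sum_v nu v = 1.

Let mean i := \sum_v nu v * z v i.

(** The increment is centred under [nu], so the cross term averages out and some draw adds at most
    the second moment. This derandomizes the sampling. *)
Lemma maurey_step (w : 'I_n -> R) : exists u,
  \sum_i (w i + (z u i - mean i)) ^+ 2 <=
  \sum_i w i ^+ 2 + \sum_v nu v * \sum_i z v i ^+ 2.
Proof.
suff [u _ Hu] : exists2 u, 0 < nu u & \sum_i (w i + (z u i - mean i)) ^+ 2 <=
    \sum_i w i ^+ 2 + \sum_v nu v * \sum_i z v i ^+ 2 by exists u.
apply: weighted_exists => //; first by rewrite nu_sum1.
rewrite nu_sum1 mulr1; under eq_bigr do rewrite mulr_sumr.
under [X in _ + X]eq_bigr do rewrite mulr_sumr.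
rewrite exchange_big [X in _ + X]exchange_big -big_split /=; apply: ler_sum => i _.
have -> : \sum_v nu v * (w i + (z v i - mean i)) ^+ 2 =
    w i ^+ 2 + \sum_v nu v * z v i ^+ 2 - mean i ^+ 2.
  transitivity (\sum_v (nu v * (w i ^+ 2 - 2 * w i * mean i + mean i ^+ 2) +
      nu v * z v i * (2 * (w i - mean i)) + nu v * z v i ^+ 2)).
    by apply: eq_bigr => v _; ring.
  rewrite !big_split /= -!mulr_suml nu_sum1 -/(mean i); ring.
by rewrite lerBlDr lerDl sqr_ge0.
Qed.

Lemma maurey k : exists2 s : seq V, size s = k &
  \sum_i (\sum_(v <- s) (z v i - mean i)) ^+ 2 <=
  k%:R * \sum_v nu v * \sum_i z v i ^+ 2.
Proof.
elim: k => [|k [s ss Hs]].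
  by exists [::] => //; rewrite mul0r big1// => i _; rewrite big_nil expr0n.
have [u Hu] := maurey_step (fun i => \sum_(v <- s) (z v i - mean i)).
exists (u :: s); first by rewrite /= ss.
under eq_bigr do rewrite big_cons addrC.
by apply: le_trans Hu _; rewrite -[k.+1%:R]natr1 mulrDl mul1r lerD2r.
Qed.

End Maurey.

(** The classes depend on the measure being approximated, while a cover needs an index set fixed
    beforehand: the sum is padded with zeros to [K] terms. *)
Lemma sum_subset_ord (R : realType) (V : finType) (U : {set V}) (v0 : V) (K : nat)
    (G : V -> R) : (#|U| <= K)%N ->
  \sum_(u in U) G u = \sum_(a < K) if (a < #|U|)%N then G (nth v0 (enum U) a) else 0.
Proof.
move=> UK; rewrite -big_mkcond /= -(big_ord_widen K (fun a => G (nth v0 (enum U) a)))//.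
by rewrite -big_enum /= (big_nth v0) big_mkord -cardE.
Qed.

Lemma sum_fiber (R : realType) (V : finType) (c : V -> V) (F : V -> R) :
  \sum_v F v = \sum_(u in [set c v | v in V]%SET) \sum_(v | c v == u) F v.
Proof. by apply: partition_big => v _; apply/imsetP; exists v. Qed.

Lemma round_coef (R : realType) (b x : R) (Q : nat) : 0 < b -> (0 < Q)%N -> `|x| <= b ->
  exists t : 'I_(2 * Q).+1, `|x - b * (t%:R / Q%:R - 1)| <= b / Q%:R.
Proof.
move=> b0 Q0 xb.
have Qp : 0 < Q%:R :> R by rewrite ltr0n.
have y1 : -1 <= x / b <= 1.
  by rewrite -ler_norml normrM normfV (gtr0_norm b0) ler_pdivrMr// mul1r.
have z0 : 0 <= Q%:R * (x / b + 1) by rewrite mulr_ge0//; lra.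
have /andP[t1 t2] := truncn_itv z0.
set m := Num.truncn _ in t1 t2.
have m2 : (m < (2 * Q).+1)%N.
  rewrite ltnS -(ler_nat R) natrM; apply: le_trans t1 _; rewrite mulrC ler_pM2r//; lra.
exists (Ordinal m2) => /=.
have -> : x - b * (m%:R / Q%:R - 1) = b / Q%:R * (Q%:R * (x / b + 1) - m%:R).
  by field; rewrite !lt0r_neq0.
rewrite normrM ger0_norm ?(divr_ge0 (ltW b0))// -[leRHS]mulr1.
apply: ler_wpM2l; first by rewrite divr_ge0// ltW.
by move: t2; rewrite -[m.+1%:R]natr1 ler_norml => ?; apply/andP; split; lra.
Qed.

(** * Covering finite combinations of ridge functions *)

Section ReluCover.
Variables (R : realType) (d : nat) (V : finType) (q : V -> 'I_d.+1 -> R).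
Hypothesis q_neq0 : forall v k, q v k != 0.
Hypothesis q_le2 : forall v k, `|q v k| <= 2.
Variables (r k n : nat) (y : 'I_n -> 'I_d.+1 -> R).
Hypothesis r_gt0 : (0 < r)%N.
Hypothesis k_gt0 : (0 < k)%N.
Hypothesis n_gt0 : (0 < n)%N.
Hypothesis V_gt0 : (0 < #|V|)%N.
Hypothesis y_le1 : forall i l, `|y i l| <= 1.

(** [None] is an ungated ridge function, used for the Maurey sample; [Some l] is the [l]-th
    coordinate gated by a representative. *)
Definition atom (a : V * option 'I_d.+1) i : R :=
  match a.2 with
  | None => relu (dot (y i) (q a.1))
  | Some l => y i l * (pos_side q (y i) a.1)%:R
  end.

Let J : finType := ('I_k + 'I_(num_cells d r) * 'I_d.+1)%type.

Lemma relu_dot_le v i : `|relu (dot (y i) (q v))| <= 2 * d.+1%:R.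
Proof.
apply: (@le_trans _ _ `|dot (y i) (q v)|).
  by rewrite /relu; case: (ltP (dot (y i) (q v)) 0) => h; rewrite ?normr0// max_l.
apply: le_trans (ler_norm_sum _ _ _) _.
rewrite mulr_natr -[X in _ *+ X]card_ord -sumr_const; apply: ler_sum => l _.
by rewrite normrM -[leRHS]mul1r; apply: ler_pM.
Qed.

Lemma atom_le a i : `|atom a i| <= 2 * d.+1%:R.
Proof.
case: a => v [l|] /=; rewrite /atom /=; last exact: relu_dot_le.
apply: (@le_trans _ _ 1); last by rewrite -[leLHS]mulr1; apply: ler_pM; rewrite ?ler1n.
by rewrite normrM -[leRHS]mulr1; apply: ler_pM => //; case: pos_side; rewrite ?normr1 ?normr0.
Qed.

(** Every direction is gated and the residuals are sampled. The residual of a sampled direction is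
    its ridge function minus its gated version, so the correction is again a combination of
    atoms. *)
Lemma relu_sum_approx (mu : V -> R) (M : R) : \sum_v `|mu v| <= M ->
  exists (a : J -> V * option 'I_d.+1) (g : J -> R),
   (forall j, `|g j| <= 4 * M) /\
   \sum_i (\sum_v mu v * relu (dot (y i) (q v)) - \sum_j g j * atom (a j) i) ^+ 2 <=
   n%:R * (M ^+ 2 * (8 * d.+1%:R ^+ 3) / (k%:R * r%:R ^+ 3)).
Proof.
move=> leM; have /card_gt0P[v0 _] := V_gt0.
have kp : 0 < k%:R :> R by rewrite ltr0n.
have rp : 0 < r%:R :> R by rewrite ltr0n.
set A : R := \sum_v `|mu v| in leM.
have A0 : 0 <= A by apply: sumr_ge0.
have M0 : 0 <= M by apply: le_trans leM.
(* Zero variation is set apart because [nu] divides by it. *)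
have [Az|Anz] := eqVneq A 0.
  exists (fun=> (v0, None)), (fun=> 0); split; first by move=> j; rewrite normr0 mulr_ge0.
  have mz v : mu v = 0.
    apply/eqP; rewrite -normr_le0 -Az /A (bigD1 v)//= lerDl; exact: sumr_ge0.
  rewrite big1 => [|i _]; last by rewrite !big1 ?subr0 ?expr0n// => *; rewrite ?mz ?mul0r.
  by rewrite !(mulr_ge0, divr_ge0, exprn_ge0)// mulr_ge0// exprn_ge0.
have Ap : 0 < A by rewrite lt_def Anz.
pose nu v : R := `|mu v| / A.
have nu0 v : 0 <= nu v by rewrite divr_ge0.
have nu1 : \sum_v nu v = 1 by rewrite -mulr_suml mulfV.
have [c cc Hc] := relu_partition q_neq0 q_le2 r_gt0 n_gt0 V_gt0 y_le1 nu0.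
pose E v i := relu (dot (y i) (q v)) - gated_dot q (c v) v (y i).
pose sg v := Num.sg (mu v).
have sg1 v : `|sg v| <= 1 by rewrite normr_sg; case: (mu v != 0).
have [s ss Hs] := maurey (fun v i => sg v * E v i) nu0 nu1 k.
have musg v : mu v = A * (nu v * sg v).
  by rewrite /nu mulrA mulrCA mulfV// mulr1 mulrC -numEsg.
(* [ka] is the signed measure of the Maurey sample. The sampled directions enter ungated, so only
   [mu' = mu - ka] is gated; its variation is at most 2M. *)
pose ka v := A / k%:R * (\sum_(u <- s) (u == v)%:R) * sg v.
pose mu' v := mu v - ka v.
have sums (F : V -> R) : \sum_(u <- s) F u = \sum_v (\sum_(u <- s) (u == v)%:R) * F v.
  under [RHS]eq_bigr do rewrite mulr_suml.
  rewrite exchange_big; apply: eq_bigr => u _.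
  rewrite (bigD1 u)//= eqxx mul1r big1 ?addr0// => v; rewrite eq_sym => /negPf ->.
  by rewrite mul0r.
have mu'2 : \sum_v `|mu' v| <= 2 * M.
  apply: (@le_trans _ _ (A + A)); last by lra.
  apply: (@le_trans _ _ (\sum_v (`|mu v| + `|ka v|))).
    by apply: ler_sum => v _; apply: ler_normB.
  rewrite big_split /=; apply: lerD => //.
  apply: (@le_trans _ _ (\sum_v A / k%:R * ((\sum_(u <- s) (u == v)%:R) * 1))).
    apply: ler_sum => v _; rewrite /ka normrM mulrA; apply: ler_pM => //.
    by rewrite ger0_norm// mulr_ge0 ?(divr_ge0 A0)// sumr_ge0.
  by rewrite -mulr_sumr -sums big_const_seq count_predT ss iter_addr_0 mulfVK// lt0r_neq0.
(* One coefficient per class and coordinate, at most 4M since |q| is at most 2. *)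
pose beta u l := \sum_(v | c v == u) mu' v * q v l.
pose U := [set c v | v in V]%SET.
pose rep (b : 'I_(num_cells d r)) := nth v0 (enum U) b.
pose a (j : J) : V * option 'I_d.+1 := match j with
  | inl j => (nth v0 s j, None) | inr bl => (rep bl.1, Some bl.2) end.
pose g (j : J) : R := match j with
  | inl j => A / k%:R * sg (nth v0 s j)
  | inr bl => if (bl.1 < #|U|)%N then beta (rep bl.1) bl.2 else 0 end.
exists a, g; split.
  move=> [j|[b l]] /=.
    rewrite normrM ger0_norm ?(divr_ge0 A0)//.
    apply: (@le_trans _ _ A); last by apply: le_trans leM _; lra.
    rewrite -[leRHS]mulr1; apply: ler_pM => //; first by rewrite divr_ge0// ltW.
    by rewrite ler_pdivrMr// ler_peMr// ler1n.
  case: ifP => _; last by rewrite normr0 mulr_ge0.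
  apply: le_trans (ler_norm_sum _ _ _) _.
  apply: (@le_trans _ _ ((\sum_v `|mu' v|) * 2)); last by lra.
  rewrite mulr_suml big_mkcond; apply: ler_sum => v _; case: ifP => _.
    by rewrite normrM; apply: ler_wpM2l.
  by rewrite mulr_ge0.
have key i : \sum_v mu v * relu (dot (y i) (q v)) - \sum_j g j * atom (a j) i =
    - (A / k%:R) * \sum_(v <- s) (sg v * E v i - \sum_v nu v * (sg v * E v i)).
  have -> : \sum_j g j * atom (a j) i =
      \sum_(u <- s) A / k%:R * sg u * relu (dot (y i) (q u)) +
      \sum_v mu' v * gated_dot q (c v) v (y i).
    rewrite /J big_sumType /=; congr (_ + _).
      by rewrite (big_nth v0) big_mkord ss.
    rewrite -(pair_big predT predT (fun (b : 'I_(num_cells d r)) (l : 'I_d.+1) => (if (b < #|U|)%N then beta (rep b) l else 0) *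
      atom (rep b, Some l) i)) /= (sum_fiber c) (sum_subset_ord v0 _ cc).
    apply: eq_bigr => b _; case: ifP => _; last by rewrite big1// => l _; rewrite mul0r.
    rewrite -/(rep b) /beta /atom /=.
    under eq_bigr do rewrite mulr_suml.
    rewrite exchange_big; apply: eq_bigr => v /eqP cv.
    rewrite /gated_dot cv /dot mulr_suml mulr_sumr; apply: eq_bigr => l _.
    by ring.
  have kaE (F : V -> R) : \sum_v ka v * F v = A / k%:R * \sum_(u <- s) sg u * F u.
    rewrite [in RHS]sums mulr_sumr; apply: eq_bigr => v _; rewrite /ka; ring.
  rewrite /mu'; under [in X in _ - (_ + X)]eq_bigr do rewrite mulrBl.
  rewrite [in X in _ - (_ + X)]sumrB kaE big_split /= sumrN big_const_seq count_predT ss.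
  rewrite iter_addr_0 -mulr_natr.
  have -> : \sum_v mu v * relu (dot (y i) (q v)) = A * (\sum_v nu v * (sg v * E v i)) +
      \sum_v mu v * gated_dot q (c v) v (y i).
    by rewrite mulr_sumr -big_split; apply: eq_bigr => v _ /=; rewrite {1 2}musg /E; ring.
  have -> : \sum_(v <- s) sg v * E v i = \sum_(u <- s) sg u * relu (dot (y i) (q u)) -
     \sum_(u <- s) sg u * gated_dot q (c u) u (y i).
    by rewrite -sumrB; apply: eq_bigr => v _; rewrite /E mulrBr.
  under eq_bigr do rewrite -mulrA.
  rewrite -mulr_sumr.
  move: (\sum_(v <- s) _) (\sum_(v <- s) _) (\sum_v _) (\sum_v _) => X Y Z W.
  by field; rewrite lt0r_neq0.
under eq_bigr do rewrite key exprMn sqrrN.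
rewrite -mulr_sumr.
apply: le_trans (ler_wpM2l (sqr_ge0 _) Hs) _.
have B : \sum_v nu v * (\sum_i (sg v * E v i) ^+ 2) <=
    n%:R * (8 * d.+1%:R ^+ 3 / r%:R ^+ 3).
  rewrite nu1 mulr1 in Hc; apply: le_trans Hc; apply: ler_sum => v _.
  apply: ler_wpM2l => //; apply: ler_sum => i _; rewrite exprMn -[leRHS]mul1r.
  apply: ler_wpM2r; first exact: sqr_ge0.
  by rewrite -[leLHS]real_normK ?num_real// expr_le1.
apply: (@le_trans _ _ ((A / k%:R) ^+ 2 * (k%:R * (n%:R * (8 * d.+1%:R ^+ 3 / r%:R ^+ 3))))).
  by apply: ler_wpM2l; [exact: sqr_ge0|apply: ler_wpM2l].
have -> : (A / k%:R) ^+ 2 * (k%:R * (n%:R * (8 * d.+1%:R ^+ 3 / r%:R ^+ 3))) =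
  A ^+ 2 * (n%:R * (8 * d.+1%:R ^+ 3 / (k%:R * r%:R ^+ 3))).
  by field; rewrite !lt0r_neq0.
have -> : n%:R * (M ^+ 2 * (8 * d.+1%:R ^+ 3) / (k%:R * r%:R ^+ 3)) =
  M ^+ 2 * (n%:R * (8 * d.+1%:R ^+ 3 / (k%:R * r%:R ^+ 3))).
  by field; rewrite !lt0r_neq0.
apply: ler_wpM2r; last by rewrite ler_sqr ?nnegrE.
by rewrite !(mulr_ge0, divr_ge0, exprn_ge0)// mulr_ge0// exprn_ge0.
Qed.

(** The atoms range over a finite set; only the coefficients, bounded by 4M, have to be rounded, at
    mesh 4M/Q. The factors 2 come from (x + y)^2 <= 2x^2 + 2y^2. *)
Lemma relu_sum_cover (Q : nat) (M : R) : (0 < Q)%N -> 0 < M ->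
  exists2 C : seq {ffun 'I_n -> R},
    size C = ((#|V| * d.+2 * (2 * Q).+1) ^ (k + num_cells d r * d.+1))%N &
  forall mu : V -> R, \sum_v `|mu v| <= M -> exists2 c, c \in C &
   \sum_i (\sum_v mu v * relu (dot (y i) (q v)) - c i) ^+ 2 <=
   n%:R * (2 * (M ^+ 2 * (8 * d.+1%:R ^+ 3) / (k%:R * r%:R ^+ 3)) +
     2 * ((k + num_cells d r * d.+1)%:R * (4 * M / Q%:R * (2 * d.+1%:R))) ^+ 2).
Proof.
move=> Q0 M0.
pose C : finType := {ffun J -> (V * option 'I_d.+1) * 'I_(2 * Q).+1}.
pose vec (x : C) : {ffun 'I_n -> R} :=
  [ffun i => \sum_j (4 * M * ((x j).2%:R / Q%:R - 1)) * atom (x j).1 i].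
exists [seq vec x | x <- enum C].
  rewrite size_map -cardE card_ffun !card_prod card_option !card_ord.
  by rewrite card_sum card_prod !card_ord.
move=> mu leM; have [a [g [gb H]]] := relu_sum_approx leM.
have M4 : 0 < 4 * M by rewrite mulr_gt0.
have /choice[t Ht] j := round_coef M4 Q0 (gb j).
pose x : C := [ffun j => (a j, t j)].
exists (vec x); first by rewrite map_f ?mem_enum.
have P i : `|\sum_j g j * atom (a j) i - vec x i| <=
    (k + num_cells d r * d.+1)%:R * (4 * M / Q%:R * (2 * d.+1%:R)).
  rewrite ffunE -sumrB; apply: le_trans (ler_norm_sum _ _ _) _.
  have -> : (k + num_cells d r * d.+1)%N = #|J| by rewrite card_sum card_prod !card_ord.
  rewrite [leRHS]mulr_natl -sumr_const; apply: ler_sum => j _.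
  by rewrite ffunE /= -mulrBl normrM; apply: ler_pM => //; apply: atom_le.
set e1 := M ^+ 2 * _ / _ in H *; set e2 := _ * _ in P *.
apply: (@le_trans _ _ (\sum_i (2 * (\sum_v mu v * relu (dot (y i) (q v)) -
    \sum_j g j * atom (a j) i) ^+ 2 + 2 * e2 ^+ 2))).
  apply: ler_sum => i _; have := P i.
  move: (\sum_v _) (\sum_j _) (vec x i) => X Y Z h.
  have h2 : (Y - Z) ^+ 2 <= e2 ^+ 2.
    by rewrite -[leLHS]real_normK ?num_real// ler_sqr// nnegrE (le_trans _ h).
  have := sqr_ge0 (X - Y - (Y - Z)); rewrite !expr2 in h2 *; nra.
rewrite big_split /= -mulr_sumr sumr_const card_ord -[X in _ + X]mulr_natl mulrDr.
by apply: lerD => //; rewrite [leRHS]mulrCA ler_wpM2l.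
Qed.

End ReluCover.

(** * Sums of independent sub-Gaussian variables *)

Local Open Scope classical_set_scope.
Import HBNNSimple.

Section Independence.
Context (dm : measure_display) (Omega : measurableType dm) (R : realType).
Variable Pr : probability Omega R.

(** Passage from indicators to nonnegative [g] through simple functions and monotone convergence;
    [Y] will be the product of the other factors. *)
Lemma integralM_comp (Y xi : Omega -> R) (c : R) (g : R -> R) :
  measurable_fun setT Y -> (forall w, 0 <= Y w) -> measurable_fun setT xi ->
  0 <= c -> measurable_fun setT g -> (forall t, 0 <= g t) ->
  (forall B, measurable B ->
    (\int[Pr]_w (Y w * \1_B (xi w))%:E = c%:E * Pr (xi @^-1` B))%E) ->
  (\int[Pr]_w (Y w * g (xi w))%:E = c%:E * \int[Pr]_w (g (xi w))%:E)%E.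
Proof.
move=> mY Y0 mxi c0 mg g0 HB.
have mgE : measurable_fun setT (EFin \o g) by exact/measurable_EFinP.
pose h := nnsfun_approx measurableT mgE.
have hcvg t : (EFin \o h n) t @[n --> \oo] --> (g t)%:E.
  by apply: (cvg_nnsfun_approx measurableT mgE) => // x _; rewrite lee_fin.
have hnd m n t : (m <= n)%N -> h m t <= h n t.
  by move=> mn; apply/lefP/nd_nnsfun_approx.
have mhx n : measurable_fun setT (fun w => h n (xi w)) by exact: measurableT_comp.
have simple n : (\int[Pr]_w (Y w * h n (xi w))%:E = c%:E * \int[Pr]_w (h n (xi w))%:E)%E.
  have mB r : measurable (h n @^-1` [set r]) by exact: measurable_sfunP.
  have mi r : measurable_fun setT (fun w => \1_(h n @^-1` [set r]) (xi w) : R).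
    by apply: measurableT_comp => //; exact: measurable_indic.
  have r0 r x : 0 <= r * \1_(h n @^-1` [set r]) x :> R.
    by have := nnfun_muleindic_ge0 (h n) r x; rewrite lee_fin.
  transitivity (\int[Pr]_w (\sum_(r \in range (h n)) (Y w * (r * \1_(h n @^-1` [set r]) (xi w)))%:E))%E.
    apply: eq_integral => w _; rewrite fsumEFin// {1}fimfunE; congr EFin.
    rewrite [LHS]mulrC; rewrite !fsbig_finite//= mulr_suml; apply: eq_bigr => r _.
    by rewrite mulrC.
  rewrite ge0_integral_fsum//; last 2 first.
  - by move=> r; apply/measurable_EFinP; apply: measurable_funM => //; exact: measurable_funM.
  - by move=> r w _; rewrite lee_fin mulr_ge0.
  transitivity (c%:E * \int[Pr]_w (\sum_(r \in range (h n)) (r * \1_(h n @^-1` [set r]) (xi w))%:E))%E; last first.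
    by congr (_ * _)%E; apply: eq_integral => w _; rewrite fsumEFin// {1}fimfunE.
  rewrite ge0_integral_fsum//; last 2 first.
  - by move=> r; apply/measurable_EFinP; apply: measurable_funM.
  - by move=> r w _; rewrite lee_fin.
  rewrite ge0_mule_fsumr; last by move=> r; apply: integral_ge0 => w _; rewrite lee_fin.
  apply: eq_fsbigr => r; rewrite inE => -[t _ ht].
  have rge0 : 0 <= r by rewrite -ht.
  under eq_integral do rewrite mulrCA EFinM.
  rewrite ge0_integralZl//; last 2 first.
  - by apply/measurable_EFinP; exact: measurable_funM.
  - by move=> w _; rewrite lee_fin mulr_ge0.
  under [in RHS]eq_integral do rewrite EFinM.
  rewrite ge0_integralZl//; last exact/measurable_EFinP.
  rewrite HB// muleCA; congr (_ * (_ * _))%E.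
  have -> : (fun w => (\1_(h n @^-1` [set r]) (xi w))%:E) =
     (fun w => (\1_(xi @^-1` (h n @^-1` [set r])) w)%:E : \bar R) by [].
  by rewrite integral_indic// ?setIT// -[X in measurable X]setTI; apply: mxi.
transitivity (limn (fun n => \int[Pr]_w (Y w * h n (xi w))%:E))%E.
  rewrite -monotone_convergence//.
  - apply: eq_integral => w _; apply/esym/cvg_lim => //.
    have := cvgeZl (y := (Y w)%:E) isT (hcvg (xi w)).
    by rewrite -EFinM; under eq_fun do rewrite -EFinM.
  - by move=> n; apply/measurable_EFinP; exact: measurable_funM.
  - by move=> n w _; rewrite lee_fin mulr_ge0.
  - by move=> w _ m n mn; rewrite lee_fin ler_wpM2l// hnd.
under eq_fun do rewrite simple.
have -> : (\int[Pr]_w (g (xi w))%:E = limn (fun n => \int[Pr]_w (h n (xi w))%:E))%E.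
  rewrite -monotone_convergence//.
  - by apply: eq_integral => w _; apply/esym/cvg_lim => //; exact: hcvg.
  - by move=> n; apply/measurable_EFinP.
  - by move=> n w _; rewrite lee_fin.
  - by move=> w _ m n mn; rewrite lee_fin hnd.
apply/cvg_lim => //; apply: cvgeZl => //.
apply: ereal_nondecreasing_is_cvgn => m n mn; apply: ge0_le_integral => //; do ?exact/measurable_EFinP;
  by move=> w _; rewrite lee_fin ?hnd.
Qed.

Lemma independent_prod n (xi : 'I_n -> Omega -> R) (H : 'I_n -> R -> R) :
  mutually_independent Pr xi -> (forall i, measurable_fun setT (H i)) ->
  (forall i t, 0 <= H i t) ->
  (forall i, (\int[Pr]_w (H i (xi i w))%:E < +oo)%E) ->
  (\int[Pr]_w (\prod_i H i (xi i w))%:E = \prod_i \int[Pr]_w (H i (xi i w))%:E)%E.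
Proof.
move=> [mxi ind] mH H0 Hfin.
have mpre i B : measurable B -> measurable (xi i @^-1` B).
  by move=> mB; rewrite -[X in measurable X]setTI; apply: mxi.
have indE i B : measurable B -> (\int[Pr]_w (\1_B (xi i w))%:E = Pr (xi i @^-1` B))%E.
  by move=> mB; rewrite (integral_indic _ measurableT (mpre i B mB)) setIT.
(* The factors are freed one at a time: those of index at least [k] are still indicators, to which
   independence applies directly. *)
suff claim k : (k <= n)%N -> forall H : 'I_n -> R -> R, (forall i, measurable_fun setT (H i)) ->
    (forall i t, 0 <= H i t) -> (forall i, (\int[Pr]_w (H i (xi i w))%:E < +oo)%E) ->
    (forall i : 'I_n, (k <= i)%N -> exists2 B, measurable B & H i = \1_B) ->
    (\int[Pr]_w (\prod_i H i (xi i w))%:E = \prod_i \int[Pr]_w (H i (xi i w))%:E)%E.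
  by apply: (claim n) => // i; rewrite leqNgt ltn_ord.
elim: k {H mH H0 Hfin} => [|k IH] kn H mH H0 Hfin HI.
  have /choice[B HB] i : exists B, measurable B /\ H i = \1_B.
    by have [//|B mB E] := HI i; exists B.
  have mB i : measurable (B i) by case: (HB i).
  transitivity (\int[Pr]_w (\1_(\bigcap_(i in [set: 'I_n]) (xi i @^-1` B i)) w)%:E)%E.
    apply: eq_integral => w _; congr EFin.
    under eq_bigr do rewrite (HB _).2.
    rewrite indicE; have [/set_mem h|/negP h] := boolP (w \in _).
      by rewrite big1// => i _; rewrite indicE mem_set//; apply: h.
    have [i hi] : exists i, ~ B i (xi i w).
      apply: contrapT => N; apply: h; apply/mem_set => i _.
      by apply: contrapT => hi; apply: N; exists i.
    by rewrite (bigD1 i)//= indicE memNset// mul0r.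
  rewrite integral_indic//; last first.
    by apply: fin_bigcap_measurable => // i _; apply: mpre.
  rewrite setIT; apply: (etrans (ind B mB)); apply: eq_bigr => i _.
  by rewrite -indE//; apply: eq_integral => w _; rewrite (HB i).2.
pose K := Ordinal kn.
have I0 i : (0 <= \int[Pr]_w (H i (xi i w))%:E)%E.
  by apply: integral_ge0 => w _; rewrite lee_fin.
pose e i := fine (\int[Pr]_w (H i (xi i w))%:E).
have eE i : (\int[Pr]_w (H i (xi i w))%:E = (e i)%:E)%E.
  by rewrite fineK// ge0_fin_numE.
have e0 i : 0 <= e i by apply: fine_ge0.
have mHx i : measurable_fun setT (fun w => H i (xi i w)).
  exact: measurableT_comp.
rewrite [RHS](bigD1 K)//= muleC.
under [X in (X * _)%E]eq_bigr do rewrite eE.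
rewrite prodEFin.
rewrite -(@integralM_comp (fun w => \prod_(i < n | i != K) H i (xi i w))) //.
- by apply: eq_integral => w _; rewrite (bigD1 K)//= mulrC.
- rewrite [X in measurable_fun _ X](_ : _ =
    fun w => \prod_(i <- [seq i <- index_enum _ | i != K]) H i (xi i w)).
    by apply: measurable_prod => i _; exact: mHx.
  by apply: funext => w; rewrite big_filter.
- by move=> w; apply: prodr_ge0.
- exact: prodr_ge0.
move=> B mB.
pose H' i := if i == K then \1_B else H i.
have mH' i : measurable_fun setT (H' i) by rewrite /H'; case: ifP => // _; exact: measurable_indic.
have := IH (ltnW kn) H' mH'.
have -> : (\int[Pr]_w (\prod_(i < n) H' i (xi i w))%:E =
   \int[Pr]_w (\prod_(i < n | i != K) H i (xi i w) * \1_B (xi K w))%:E)%E.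
  apply: eq_integral => w _; rewrite (bigD1 K)//= mulrC /H' eqxx; congr (_ * _)%:E.
  by apply: eq_bigr => i /negPf ->.
move=> ->.
- rewrite (bigD1 K)//= muleC; congr (_ * _)%E.
    rewrite -prodEFin; apply: eq_bigr => i /negPf iK; rewrite -eE.
    by apply: eq_integral => w _; rewrite /H' iK.
  by rewrite -indE//; apply: eq_integral => w _; rewrite /H' eqxx.
- by move=> i t; rewrite /H'; case: ifP.
- move=> i; rewrite /H'; case: ifP => // /eqP _; rewrite indE//.
  by apply: le_lt_trans (probability_le1 _ _) (ltry _); apply: mpre.
- move=> i ki; rewrite /H'; case: eqP => [_|iK]; first by exists B.
  by apply: HI; rewrite ltn_neqAle ki andbT; apply: contra_not_neq iK => ?; apply: val_inj.
Qed.

Lemma sub_gaussian_sum n (xi : 'I_n -> Omega -> R) (s : R) (a : 'I_n -> R) :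
  mutually_independent Pr xi -> (forall i, sub_gaussian Pr s (xi i)) ->
  (\int[Pr]_w (expR (\sum_i a i * xi i w))%:E <= (expR (s ^+ 2 * (\sum_i a i ^+ 2) / 2))%:E)%E.
Proof.
move=> ind sg.
under eq_integral do rewrite expR_sum.
rewrite (@independent_prod n xi (fun i t => expR (a i * t)))//.
- have -> : expR (s ^+ 2 * (\sum_i a i ^+ 2) / 2) = \prod_i expR (s ^+ 2 * a i ^+ 2 / 2).
    by rewrite -expR_sum -mulr_suml -mulr_sumr.
  pose e i := fine (\int[Pr]_w (expR (a i * xi i w))%:E).
  have I0 i : (0 <= \int[Pr]_w (expR (a i * xi i w))%:E)%E.
    by apply: integral_ge0 => w _; rewrite lee_fin expR_ge0.
  have eE i : (\int[Pr]_w (expR (a i * xi i w))%:E = (e i)%:E)%E.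
    by rewrite fineK// ge0_fin_numE//; apply: le_lt_trans (sg i (a i)) (ltry _).
  rewrite (eq_bigr (fun i => (e i)%:E)); last by move=> i _; exact: eE.
  rewrite prodEFin lee_fin; apply: ler_prod => i _; rewrite fine_ge0//=.
  by rewrite -lee_fin -eE; apply: sg.
- move=> i; apply: measurableT_comp => //; exact: measurable_funM.
- by move=> i; apply: le_lt_trans (sg i (a i)) (ltry _).
Qed.

End Independence.

(** * Discretization of the representing measure *)

Import numFieldNormedType.Exports.
Section StepIntegral.
Context (dt : measure_display) (T : measurableType dt) (R : realType).
Variables (m : {finite_measure set T -> \bar R}) (S : set T) (V : finType).
Variables (cell : V -> set T) (idx : T -> V) (g : T -> R) (c : V -> R) (e : R).
Hypothesis mS : measurable S.
Hypothesis mcell : forall v, measurable (cell v).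
Hypothesis cellP : forall w v, S w -> cell v w <-> idx w = v.
Hypothesis mg : measurable_fun S g.
Hypothesis g_ge0 : forall w, 0 <= g w.
Hypothesis c_ge0 : forall v, 0 <= c v.
Hypothesis e_ge0 : 0 <= e.
Hypothesis ge : forall w, S w -> `|g w - c (idx w)| <= e.

Definition cell_mass v : R := fine (m (cell v `&` S)).

Lemma cell_mass_ge0 v : 0 <= cell_mass v.
Proof. exact: fine_ge0. Qed.

Lemma cell_massE v : (m (cell v `&` S) = (cell_mass v)%:E)%E.
Proof. by rewrite /cell_mass fineK// fin_num_measure//; exact: measurableI. Qed.

Lemma integral_step (b : V -> R) : (forall v, 0 <= b v) ->
  (\int[m]_(w in S) (b (idx w))%:E = (\sum_v cell_mass v * b v)%:E)%E.
Proof.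
move=> b0.
transitivity (\int[m]_(w in S) \sum_v ((b v)%:E * (\1_(cell v) w)%:E))%E.
  apply: eq_integral => w /set_mem Sw.
  rewrite (bigD1 (idx w))//= [X in (_ + X)%E]big1 => [|v vi].
    by rewrite indicE mem_set ?mule1 ?adde0//; apply/cellP.
  rewrite indicE memNset ?mule0// => /(cellP _ Sw) E.
  by rewrite E eqxx in vi.
have mi v : measurable_fun S (fun w => (\1_(cell v) w)%:E : \bar R).
  by apply/measurable_EFinP; exact: measurable_indic.
rewrite ge0_integral_sum//; last 2 first.
- by move=> v; apply: emeasurable_funM.
- by move=> v w _; rewrite mule_ge0 ?lee_fin.
rewrite -sumEFin; apply: eq_bigr => v _.
rewrite ge0_integralZl//; last by rewrite lee_fin.
rewrite integral_indic// mulrC EFinM; congr (_ * _)%E; exact: cell_massE.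
Qed.

Lemma sum_cell_mass : \sum_v cell_mass v = fine (m S).
Proof.
have := @integral_step (fun=> 1) (fun=> ler01).
rewrite (@integral_cst _ _ _ m _ mS 1%:E) mul1e => ->; rewrite /=.
by apply: eq_bigr => v _; rewrite mulr1.
Qed.

Lemma step_integral_approx :
  `|fine (\int[m]_(w in S) (g w)%:E) - \sum_v cell_mass v * c v| <= e * \sum_v cell_mass v.
Proof.
have mgE : measurable_fun S (fun w => (g w)%:E : \bar R) by exact/measurable_EFinP.
have mce : measurable_fun S (fun w => (c (idx w))%:E : \bar R).
  apply: (@eq_measurable_fun _ _ _ _ S (fun w => \sum_v ((c v)%:E * (\1_(cell v) w)%:E))%E).
    move=> w /set_mem Sw.
    rewrite (bigD1 (idx w))//= [X in (_ + X)%E]big1 => [|v vi].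
      by rewrite indicE mem_set ?mule1 ?adde0//; apply/cellP.
    rewrite indicE memNset ?mule0// => /(cellP _ Sw) E.
    by rewrite E eqxx in vi.
  apply: emeasurable_sum => v; apply: emeasurable_funM => //.
  by apply/measurable_EFinP; exact: measurable_indic.
have I0 : (0 <= \int[m]_(w in S) (g w)%:E)%E.
  by apply: integral_ge0 => w _; rewrite lee_fin.
(* The upper bound comes first: it gives the finiteness that [fine] requires. *)
have up : (\int[m]_(w in S) (g w)%:E <=
    (\sum_v cell_mass v * c v + e * \sum_v cell_mass v)%:E)%E.
  have -> : \sum_v cell_mass v * c v + e * \sum_v cell_mass v = \sum_v cell_mass v * (c v + e).
    by rewrite mulr_sumr -big_split; apply: eq_bigr => v _ /=; rewrite mulrDr [e * _]mulrC.
  rewrite -integral_step; last by move=> v; rewrite addr_ge0.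
  apply: ge0_le_integral => //.
  - by move=> w _; rewrite lee_fin.
  - rewrite (_ : (fun w => _) = (fun w => (c (idx w))%:E + e%:E)%E)//.
    by apply: emeasurable_funD.
  - move=> w /ge; rewrite lee_fin ler_norml => /andP[_]; lra.
have fin : (\int[m]_(w in S) (g w)%:E)%E \is a fin_num.
  by rewrite ge0_fin_numE//; apply: le_lt_trans up (ltry _).
have lo : ((\sum_v cell_mass v * c v)%:E <=
    \int[m]_(w in S) (g w)%:E + (e * \sum_v cell_mass v)%:E)%E.
  rewrite -integral_step//.
  have -> : (e * \sum_v cell_mass v)%:E = (\int[m]_(w in S) (cst e%:E) w)%E.
    by rewrite integral_cst// EFinM sum_cell_mass fineK// fin_num_measure.
  rewrite -ge0_integralD//; last by move=> w _; rewrite lee_fin.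
  apply: ge0_le_integral => //.
  - by move=> w _; rewrite lee_fin.
  - by apply: emeasurable_funD.
  - by move=> w /ge; rewrite lee_fin ler_norml => /andP[+ _]; lra.
move: up lo; rewrite -(fineK fin) -EFinD !lee_fin /= => up lo.
by rewrite ler_norml; apply/andP; split; lra.
Qed.

End StepIntegral.

(** * Grid nodes near the sphere of directions *)

Section Nodes.
Variables (R : realType) (d Q : nat).
Hypothesis Q_gt0 : (0 < Q)%N.

Let Qp : 0 < Q%:R :> R. Proof. by rewrite ltr0n. Qed.

(* Odd multiples of 1/(2Q): never 0, so every node vector lies on a well-defined face. *)
Definition node (j : 'I_(2 * Q).+1) : R := (2 * j).+1%:R / (2 * Q)%:R - 1.

Lemma node_neq0 j : node j != 0.
Proof.
rewrite /node subr_eq0 -[eqbRHS](@divff _ (2 * Q)%:R) ?pnatr_eq0 -?lt0n ?muln_gt0//.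
apply/eqP => /divIf; rewrite pnatr_eq0 -lt0n muln_gt0 => /(_ Q_gt0) /eqP.
by rewrite eqr_nat => /eqP /(congr1 odd); rewrite /= !oddM.
Qed.

Lemma node_le2 j : `|node j| <= 2.
Proof.
have jQ : (2 * j).+1%:R <= 3 * (2 * Q)%:R :> R.
  by rewrite -natrM ler_nat; have := ltn_ord j; move: Q_gt0; lia.
have Q2 : 0 < (2 * Q)%:R :> R by rewrite ltr0n muln_gt0.
rewrite /node ler_norml; apply/andP; split.
  have : 0 <= (2 * j).+1%:R / (2 * Q)%:R :> R by rewrite divr_ge0.
  lra.
by rewrite lerBlDr ler_pdivrMr//; lra.
Qed.

Lemma node_close (j : 'I_(2 * Q).+1) (t : R) :
  j%:R <= Q%:R * (t + 1) < j.+1%:R -> `|t - node j| <= Q%:R^-1.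
Proof.
move=> /andP[h1 h2].
have -> : t - node j = (Q%:R * (t + 1) - j%:R - 2^-1) / Q%:R.
  by rewrite /node -[(2 * j).+1%:R]natr1 !natrM; field; rewrite lt0r_neq0.
rewrite normrM normfV (gtr0_norm Qp) -[leRHS]mul1r ler_pM2r ?invr_gt0//.
by move: h2; rewrite -[j.+1%:R]natr1 ler_norml => h2; apply/andP; split; lra.
Qed.

Definition aug (x : 'rV[R]_d) (k : 'I_d.+1) : R :=
  if insub (k : nat) is Some i then x ord0 i else 1.

Lemma aug_widen x (i : 'I_d) : aug x (widen_ord (leqnSn d) i) = x ord0 i.
Proof. by rewrite /aug /= valK. Qed.

Lemma dot_aug x (w : 'rV[R]_d.+1) : dot (aug x) (w ord0) = aug_dot x w.
Proof.
rewrite /dot /aug_dot big_ord_recr /=; congr (_ + _).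
  by apply: eq_bigr => i _; rewrite aug_widen.
by rewrite /aug insubN ?mul1r//= ltnn.
Qed.

Lemma aug_le1 x k : unit_ball x -> `|aug x k| <= 1.
Proof.
rewrite /unit_ball /= /aug => xb; case: insubP => [i _ _|_]; last by rewrite normr1.
rewrite -(@expr_le1 _ 2)// real_normK ?num_real//; apply: le_trans xb.
by rewrite (bigD1 i)//= lerDl sumr_ge0// => j _; rewrite sqr_ge0.
Qed.

Definition node_index : finType := {ffun 'I_d.+1 -> 'I_(2 * Q).+1}.
Definition nodes (v : node_index) (k : 'I_d.+1) : R := node (v k).

Local Notation borelRV := (g_sigma_algebraType (@open 'rV[R]_d.+1)).

(** Half-open boxes of side 1/Q; on the sphere, index 2Q is reached only by the coordinate value
    1. *)
Definition node_cell (v : node_index) : set borelRV :=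
  [set w : 'rV[R]_d.+1 | forall k, (v k)%:R <= Q%:R * (w ord0 k + 1) < (v k).+1%:R].

Definition node_of (w : 'rV[R]_d.+1) : node_index :=
  [ffun k => inord (Num.truncn (Q%:R * (w ord0 k + 1)))].

Lemma sphere_coord (w : 'rV[R]_d.+1) k : unit_sphere w -> -1 <= w ord0 k <= 1.
Proof.
rewrite /unit_sphere /= => E; rewrite -ler_norml -(@expr_le1 _ 2)// real_normK ?num_real//.
by rewrite -[leRHS]E (bigD1 k)//= lerDl sumr_ge0// => j _; rewrite sqr_ge0.
Qed.

Lemma node_cellP (w : borelRV) (v : node_index) :
  (unit_sphere (w : 'rV[R]_d.+1)) -> node_cell v w <-> node_of w = v.
Proof.
move=> Sw.
have z0 k : 0 <= Q%:R * ((w : 'rV[R]_d.+1) ord0 k + 1).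
  by rewrite mulr_ge0//; have := sphere_coord k Sw; lra.
have lt k : (Num.truncn (Q%:R * ((w : 'rV[R]_d.+1) ord0 k + 1)) < (2 * Q).+1)%N.
  rewrite ltnS -(ler_nat R) natrM; have /andP[h _] := truncn_itv (z0 k).
  apply: le_trans h _; rewrite mulrC ler_pM2r//; have := sphere_coord k Sw; lra.
split=> [h|<- k]; last by rewrite ffunE inordK//; apply: truncn_itv.
apply/ffunP => k; rewrite ffunE; apply: val_inj; rewrite /= inordK//.
exact/truncn_def.
Qed.

Lemma measurable_coord k : measurable_fun setT (fun w : borelRV => (w : 'rV[R]_d.+1) ord0 k).
Proof.
apply: (measurability _ (RGenOpens.measurableE R)) => _ [U [a [b ->]] <-].
rewrite setTI; apply: sub_sigma_algebra.
by apply: open_comp; [move=> w _; exact: coord_continuous|exact: interval_open].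
Qed.

Lemma measurable_sphere : measurable (@unit_sphere R d : set borelRV).
Proof.
have -> : (@unit_sphere R d : set borelRV) = setT `&`
    (fun w : borelRV => \sum_(k < d.+1) ((w : 'rV[R]_d.+1) ord0 k) ^+ 2) @^-1` [set 1].
  by rewrite setTI.
apply: measurable_sum => // k; apply: measurable_funX; exact: measurable_coord.
Qed.

Lemma measurable_node_cell v : measurable (node_cell v).
Proof.
have -> : node_cell v = \bigcap_(k in [set: 'I_d.+1])
    ((fun w : borelRV => Q%:R * ((w : 'rV[R]_d.+1) ord0 k + 1)) @^-1`
      `[(v k)%:R, (v k).+1%:R[%classic).
  by apply/seteqP; split=> w /= h k; have := h k; rewrite /= in_itv /=; [|apply].
apply: fin_bigcap_measurable => // k _; rewrite -[X in measurable X]setTI.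
suff : measurable_fun setT (fun w : borelRV => Q%:R * ((w : 'rV[R]_d.+1) ord0 k + 1)).
  by apply => //; exact: measurable_itv.
apply: measurable_funM => //; apply: measurable_funD => //; exact: measurable_coord.
Qed.

Lemma measurable_relu_aug x :
  measurable_fun setT (fun w : borelRV => relu (aug_dot x (w : 'rV[R]_d.+1))).
Proof.
apply: measurable_maxr => //; apply: measurable_funD; last exact: measurable_coord.
by apply: measurable_sum => k; apply: measurable_funM => //; exact: measurable_coord.
Qed.

Lemma relu_lip (a b : R) : `|relu a - relu b| <= `|a - b|.
Proof.
rewrite /relu; have [a0|a0] := ltP a 0; have [b0|b0] := ltP b 0;
  rewrite ?(max_r (ltW _)) ?max_l// ?subrr ?normr0//.
- by rewrite sub0r normrN ger0_norm// [leRHS]distrC ger0_norm; lra.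
- by rewrite subr0 !ger0_norm; lra.
Qed.

Lemma relu_node_close x (w : 'rV[R]_d.+1) : unit_ball x -> unit_sphere w ->
  `|relu (aug_dot x w) - relu (dot (aug x) (nodes (node_of w)))| <= d.+1%:R / Q%:R.
Proof.
move=> xb Sw; apply: le_trans (relu_lip _ _) _.
rewrite -dot_aug /dot -sumrB; apply: le_trans (ler_norm_sum _ _ _) _.
rewrite mulr_natl -[X in _ *+ X]card_ord -sumr_const; apply: ler_sum => k _.
rewrite -mulrBr normrM -[leRHS]mul1r; apply: ler_pM => //; first exact: aug_le1.
by apply: node_close; have /(node_cellP _ Sw) := erefl (node_of w); apply.
Qed.

Lemma discretize_measure (m : {finite_measure set borelRV -> \bar R}) :
  exists2 mu : node_index -> R, (forall v, 0 <= mu v) /\ \sum_v mu v = fine (m (@unit_sphere R d : set borelRV)) &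
  forall x, unit_ball x ->
  `|fine (\int[m]_(w in (@unit_sphere R d : set borelRV)) (relu (aug_dot x (w : 'rV[R]_d.+1)))%:E)
    - \sum_v mu v * relu (dot (aug x) (nodes v))| <= d.+1%:R / Q%:R * \sum_v mu v.
Proof.
have r0 t : 0 <= relu t :> R by rewrite /relu le_max lexx orbT.
exists (cell_mass m (@unit_sphere R d : set borelRV) node_cell).
  split; first by move=> v; exact: cell_mass_ge0.
  by apply: (sum_cell_mass _ _ _ node_cellP); [exact: measurable_sphere|exact: measurable_node_cell].
move=> x xb.
apply: (@step_integral_approx _ _ _ m _ _ node_cell node_of _ (fun v => relu (dot (aug x) (nodes v)))) => //.
- exact: measurable_sphere.
- exact: measurable_node_cell.
- exact: node_cellP.
- by apply: measurable_funTS; exact: measurable_relu_aug.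
- by move=> w Sw; exact: relu_node_close.
Qed.

Lemma F_sigma_discretize (M : R) (f : 'rV[R]_d -> R) : 0 < M -> F_sigma_M M f ->
  exists2 mu : node_index -> R, \sum_v `|mu v| <= 2 * M &
  forall x, unit_ball x ->
    `|f x - \sum_v mu v * relu (dot (aug x) (nodes v))| <= d.+1%:R / Q%:R * (2 * M).
Proof.
move=> M0 [_ gM].
(* The infimum need not be attained; the slack up to 2M yields an actual representing measure. *)
have lt : (gamma f < (2 * M)%:E)%E by apply: le_lt_trans gM _; rewrite lte_fin; lra.
have [t [m [P [N [h [Hf ->]]]]] tM] := ereal_inf_lt lt.
set S := (@unit_sphere R d : set borelRV).
have [mp [mp0 sp] Hp] := discretize_measure (jordan_pos h).
have [mn [mn0 sn] Hn] := discretize_measure (jordan_neg h).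
have fp : jordan_pos h S \is a fin_num by apply: fin_num_measure; exact: measurable_sphere.
have fn : jordan_neg h S \is a fin_num by apply: fin_num_measure; exact: measurable_sphere.
have tv : \sum_v mp v + \sum_v mn v <= 2 * M.
  by rewrite sp sn -lee_fin EFinD !fineK//; apply: ltW.
exists (fun v => mp v - mn v).
  apply: le_trans tv; rewrite -big_split; apply: ler_sum => v _ /=.
  by apply: le_trans (ler_normB _ _) _; rewrite !ger0_norm.
move=> x xb; rewrite Hf// /f_mu -/S.
under eq_bigr do rewrite mulrBl.
rewrite sumrB; have := Hp x xb; have := Hn x xb; rewrite -/S.
move: (fine _) (fine _) (\sum_v _ * _) (\sum_v _ * _) => a b a' b' hb ha.
apply: (@le_trans _ _ (d.+1%:R / Q%:R * (\sum_v mp v + \sum_v mn v))); last first.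
  by apply: ler_wpM2l => //; rewrite divr_ge0.
rewrite mulrDr; apply: le_trans (lerD ha hb).
have -> : a - b - (a' - b') = (a - a') - (b - b') by ring.
exact: ler_normB.
Qed.

End Nodes.

(** * Metric entropy *)

Section Entropy.
Variables (R : realType) (d : nat).

(** From 2(d + 1)^2 (2r + 1) + r + 1 <= (6(d + 1)^2 + 2) r for r >= 1. *)
Definition cell_const := (d.+1 * 2 * (6 * d.+1 ^ 2 + 2) ^ d)%N.
Definition term_const := (1 + cell_const * d.+1)%N.
(** Exponent of rho + 1, per rho^(2d): (d + 2)(3d + 6) for the node, kind and coefficient of each
    term, and 3d + 5 for the factor of the star hull. *)
Definition entropy_const := (term_const * (d.+2 * (3 * d + 6)) + (3 * d + 5))%N.

Lemma num_cells_le r : (0 < r)%N -> (num_cells d r <= cell_const * r ^ d)%N.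
Proof.
move=> r0; rewrite /num_cells /cell_const -mulnA -[X in (_ <= X)%N]mulnA.
rewrite -[X in (_ <= X)%N]mulnA; rewrite -expnMn; do 2 apply: leq_mul => //.
have : ((d.+1 * (d.+1 * 2) * (2 * r).+1 + r).+1 <= (6 * d.+1 ^ 2 + 2) * r)%N by nia.
by case: d => [//|d'] h; rewrite leq_exp2r.
Qed.

Lemma num_terms_le r : (0 < r)%N -> (r ^ d + num_cells d r * d.+1 <= term_const * r ^ d)%N.
Proof. by move=> /num_cells_le; rewrite /term_const; nia. Qed.

Lemma cover_size_le rho Q N : (0 < rho)%N -> Q = (rho ^ (3 * d + 3))%N ->
  (N <= term_const * (rho ^ 2) ^ d)%N ->
  (((2 * Q).+1 ^ d.+1 * d.+2 * (2 * Q).+1) ^ N * Q.+1 <=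
    rho.+1 ^ (entropy_const * rho ^ (2 * d)))%N.
Proof.
move=> r0 EQ leN.
have Q0 : (0 < Q)%N by rewrite EQ expn_gt0 r0.
have q : ((2 * Q).+1 <= rho.+1 ^ (3 * d + 5))%N.
  apply: (@leq_trans (2 ^ 2 * rho ^ (3 * d + 3))); first by rewrite -EQ; lia.
  have -> : (3 * d + 5 = 2 + (3 * d + 3))%N by lia.
  by rewrite [X in (_ <= X)%N]expnD; apply: leq_mul; rewrite leq_exp2r//; lia.
have dd : (d.+2 <= rho.+1 ^ d.+2)%N.
  by apply: leq_trans (ltnW (ltn_expl d.+2 (isT : 1 < 2)%N)) _; rewrite leq_exp2r.
have base : ((2 * Q).+1 ^ d.+1 * d.+2 * (2 * Q).+1 <= rho.+1 ^ (d.+2 * (3 * d + 6)))%N.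
  apply: (@leq_trans ((2 * Q).+1 ^ d.+2 * d.+2)); first by rewrite [X in (_ <= X * _)%N]expnSr mulnAC.
  have -> : (d.+2 * (3 * d + 6) = (3 * d + 5) * d.+2 + d.+2)%N by lia.
  by rewrite expnD; apply: leq_mul => //; rewrite expnM leq_exp2r.
have p0 : (0 < rho ^ (2 * d))%N by rewrite expn_gt0 r0.
apply: (@leq_trans (rho.+1 ^ (d.+2 * (3 * d + 6) * N) * rho.+1 ^ (3 * d + 5))).
  apply: leq_mul.
    by rewrite expnM; case: N {leN} => [//|N]; rewrite leq_exp2r.
  by apply: leq_trans q; lia.
rewrite -expnD leq_exp2l; last by lia.
rewrite -expnM in leN; rewrite /entropy_const mulnDl; apply: leq_add; last by nia.
by rewrite [X in (_ <= X)%N]mulnAC [X in (X <= _)%N]mulnC leq_mul2r leN orbT.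
Qed.

(** 40 = 36 + 4 comes from rounding the star factor and discretizing the measure, 64 from the
    approximation, 512 from rounding the coefficients, 3 from squaring a sum of three errors. Being
    at least 1, the constant is dominated by its square, so no root is extracted. *)
Definition error_const : R :=
  1 + 3 * (40 * d.+1%:R ^+ 2 + 64 * d.+1%:R ^+ 3 + 512 * d.+1%:R ^+ 2 * term_const%:R ^+ 2).

Lemma error_const_ge1 : 1 <= error_const.
Proof.
rewrite /error_const; have D0 : 0 <= d.+1%:R :> R by exact: ler0n.
have t0 : 0 <= term_const%:R :> R by exact: ler0n.
move: (d.+1%:R) (term_const%:R) D0 t0 => D t D0 t0.
have h2 := exprn_ge0 2 D0; have h3 := exprn_ge0 3 D0.
have h4 := mulr_ge0 h2 (exprn_ge0 2 t0); lra.
Qed.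

Lemma round_unit (a : R) (Q : nat) : (0 < Q)%N -> 0 <= a <= 1 ->
  exists2 t : 'I_Q.+1, (0 <= t%:R / Q%:R :> R) && (t%:R / Q%:R <= 1 :> R) & `|a - t%:R / Q%:R| <= Q%:R^-1.
Proof.
move=> Q0 /andP[a0 a1]; have Qp : 0 < Q%:R :> R by rewrite ltr0n.
have z0 : 0 <= Q%:R * a by rewrite mulr_ge0.
have /andP[t1 t2] := truncn_itv z0; set m := Num.truncn _ in t1 t2.
have mQ : (m < Q.+1)%N by rewrite ltnS -(ler_nat R) (le_trans t1)// ler_piMr.
exists (Ordinal mQ) => /=.
  by rewrite divr_ge0//= ler_pdivrMr// mul1r ler_nat -ltnS.
have -> : a - m%:R / Q%:R = (Q%:R * a - m%:R) / Q%:R by field; rewrite lt0r_neq0.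
rewrite normrM normfV (gtr0_norm Qp) -[leRHS]mul1r ler_pM2r ?invr_gt0//.
by move: t2; rewrite -[m.+1%:R]natr1 ler_norml => ?; apply/andP; split; lra.
Qed.

(** The values f(X_i) are covered; [phi] and a rounded factor are then applied to the cover
    elements, and the contraction property carries the error over. *)
Lemma star_cover (phi : R -> R) (rho n : nat) (M : R) (X : 'I_n -> 'rV[R]_d) :
  (forall s t, `|phi s - phi t| <= `|s - t|) -> phi 0 = 0 ->
  (0 < rho)%N -> (0 < n)%N -> 0 < M -> (forall i, unit_ball (X i)) ->
  exists2 C : seq {ffun 'I_n -> R},
    (size C <= rho.+1 ^ (entropy_const * rho ^ (2 * d)))%N &
  forall f a, F_sigma_M M f -> 0 <= a <= 1 -> exists2 c, c \in C &
    \sum_i (a * phi (f (X i)) - c i) ^+ 2 <= n%:R * (error_const * M / rho%:R ^+ (d + 3)) ^+ 2.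
Proof.
move=> lip phi0 r0 n0 M0 XB.
(* There are O(rho^(2d)) coefficients to round, so Q = rho^(3d+3) brings their total error, relative
   to M, down to O(rho^-(d+3)). The existentials keep the powers opaque. *)
have [Q EQ] : exists Q, Q = (rho ^ (3 * d + 3))%N by eexists.
have Q0 : (0 < Q)%N by rewrite EQ expn_gt0 r0.
have Qp : 0 < Q%:R :> R by rewrite ltr0n.
have [r Er] : exists r, r = (rho ^ 2)%N by eexists.
have r1 : (0 < r)%N by rewrite Er expn_gt0 r0.
have [k Ek] : exists k, k = (r ^ d)%N by eexists.
have k0 : (0 < k)%N by rewrite Ek expn_gt0 r1.
pose y i := aug (X i).
have y1 i l : `|y i l| <= 1 by exact: aug_le1.
have V0 : (0 < #|node_index d Q|)%N by rewrite card_ffun expn_gt0 card_ord.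
have M2 : 0 < 2 * M by rewrite mulr_gt0.
have [C0 sC0 HC0] := @relu_sum_cover R d (node_index d Q) (@nodes R d Q)
  (fun v k => node_neq0 R Q0 (v k)) (fun v k => node_le2 R Q0 (v k)) r k n y r1 k0 n0 V0 y1 Q (2 * M) Q0 M2.
pose C := [seq [ffun i => (t : 'I_Q.+1)%:R / Q%:R * phi (c i)] | c : {ffun 'I_n -> R} <- C0, t <- enum 'I_Q.+1].
exists C.
  rewrite size_allpairs sC0 size_enum_ord card_ffun !card_ord.
  by apply: cover_size_le => //; rewrite Ek -Er; exact: num_terms_le.
move=> f a Hf a01.
have [mu muM Hmu] := F_sigma_discretize Q0 M0 Hf.
have [c cC Hc] := HC0 mu muM.
have [t t01 Ht] := round_unit Q0 a01.
exists [ffun i => t%:R / Q%:R * phi (c i)].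
  by apply/allpairsP; exists (c, t); rewrite mem_enum.
pose D : R := d.+1%:R.
have D0 : 0 <= D by [].
pose b i := \sum_v mu v * relu (dot (y i) (nodes R v)).
have fb i : `|f (X i) - b i| <= D / Q%:R * (2 * M) by apply: Hmu.
have bb i : `|b i| <= 2 * M * (2 * D).
  apply: le_trans (ler_norm_sum _ _ _) _.
  apply: (@le_trans _ _ ((\sum_v `|mu v|) * (2 * D))); last first.
    by apply: ler_wpM2r => //; rewrite mulr_ge0.
  rewrite mulr_suml; apply: ler_sum => v _; rewrite normrM; apply: ler_wpM2l => //.
  by apply: relu_dot_le => // u l; exact: node_le2.
have Q1 : Q%:R^-1 <= 1 :> R by rewrite invf_le1// ler1n.
(* Rounding the factor [a] costs |phi(f)|/Q, hence this a priori bound. *)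
have ff i : `|f (X i)| <= 6 * D * M.
  have -> : f (X i) = f (X i) - b i + b i by rewrite subrK.
  apply: le_trans (ler_normD _ _) _; apply: le_trans (lerD (fb i) (bb i)) _.
  have : D / Q%:R * (2 * M) <= D * (2 * M).
    by apply: ler_wpM2r; [exact: ltW|rewrite -[leRHS]mulr1; apply: ler_wpM2l].
  by rewrite -/D; nra.
have pf i : `|phi (f (X i))| <= 6 * D * M.
  by apply: le_trans (ff i); have := lip (f (X i)) 0; rewrite phi0 !subr0.
pose e0 := 6 * D * M / Q%:R; pose e1 := D / Q%:R * (2 * M).
have pt i : (a * phi (f (X i)) - [ffun i => t%:R / Q%:R * phi (c i)] i) ^+ 2 <=
    3 * (e0 ^+ 2 + e1 ^+ 2 + (b i - c i) ^+ 2).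
  rewrite ffunE.
  have -> : a * phi (f (X i)) - t%:R / Q%:R * phi (c i) =
    (a - t%:R / Q%:R) * phi (f (X i)) + t%:R / Q%:R * (phi (f (X i)) - phi (c i)) by ring.
  have h1 : `|(a - t%:R / Q%:R) * phi (f (X i))| <= e0.
    by rewrite normrM /e0 mulrC; apply: ler_pM.
  have h2 : `|t%:R / Q%:R * (phi (f (X i)) - phi (c i))| <= e1 + `|b i - c i|.
    rewrite normrM -[leRHS]mul1r; apply: ler_pM => //.
      by rewrite ger0_norm; case/andP: t01.
    apply: le_trans (lip _ _) _.
    have -> : f (X i) - c i = f (X i) - b i + (b i - c i) by ring.
    by apply: le_trans (ler_normD _ _) _; apply: lerD.
  have h : `|(a - t%:R / Q%:R) * phi (f (X i)) + t%:R / Q%:R * (phi (f (X i)) - phi (c i))|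
      <= e0 + (e1 + `|b i - c i|) by apply: le_trans (ler_normD _ _) _; apply: lerD.
  rewrite -[leLHS]real_normK ?num_real// -[(b i - c i) ^+ 2]real_normK ?num_real//.
  have E0 : 0 <= e0 by rewrite /e0 divr_ge0// !mulr_ge0// ltW.
  have E1 : 0 <= e1 by rewrite /e1 mulr_ge0 ?divr_ge0// ltW.
  have w0 := normr_ge0 (b i - c i); move: h w0.
  set u := `|_ + _|; set w := `|b i - c i| => h w0.
  have u0 : 0 <= u by exact: normr_ge0.
  apply: (@le_trans _ _ ((e0 + (e1 + w)) ^+ 2)); first by rewrite ler_sqr// nnegrE !addr_ge0.
  have := sqr_ge0 (e0 - e1); have := sqr_ge0 (e0 - w); have := sqr_ge0 (e1 - w).
  by rewrite !expr2; nra.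
apply: le_trans (ler_sum _ (fun i _ => pt i)) _.
rewrite -mulr_sumr big_split /= sumr_const card_ord -[(e0 ^+ 2 + _) *+ _]mulr_natl.
move: Hc; rewrite -/(b _) => Hc.
have [Z EZ] : exists Z : R, Z = rho%:R ^+ (d + 3) by eexists.
rewrite -EZ.
have rp : 0 < rho%:R :> R by rewrite ltr0n.
have Zp : 0 < Z by rewrite EZ exprn_gt0.
have QE : Q%:R^-1 <= Z^-1.
  rewrite lef_pV2 ?posrE// EZ EQ -natrX ler_nat; apply: leq_pexp2l => //.
  by clear; lia.
set N := (k + _)%N in Hc.
have NQ : N%:R / Q%:R <= term_const%:R / Z.
  rewrite ler_pdivrMr// mulrAC ler_pdivlMr// EZ EQ -!natrX -!natrM ler_nat /N Ek.
  apply: leq_trans (leq_mul (num_terms_le r1) (leqnn _)) _.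
  rewrite -mulnA Er -expnM -expnD leq_mul2l; apply/orP; right.
  by apply: leq_pexp2l => //; clear; lia.
have kr : k%:R * r%:R ^+ 3 = Z ^+ 2.
  rewrite Ek Er EZ -!natrX -natrM -!expnM -expnD; congr (_ ^ _)%N%:R.
  by clear; lia.
rewrite kr in Hc.
apply: (@le_trans _ _ (3 * (n%:R * (e0 ^+ 2 + e1 ^+ 2) + n%:R *
    (2 * ((2 * M) ^+ 2 * (8 * d.+1%:R ^+ 3) / Z ^+ 2) +
     2 * (N%:R * (4 * (2 * M) / Q%:R * (2 * d.+1%:R))) ^+ 2)))).
  by apply: ler_wpM2l => //; apply: lerD.
rewrite -mulrDr mulrCA; apply: ler_wpM2l => //.
rewrite -/D.
have q2 : (Q%:R^-1) ^+ 2 <= (Z^-1) ^+ 2 by rewrite ler_sqr// nnegrE invr_ge0 ltW.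
have n2 : (N%:R / Q%:R) ^+ 2 <= (term_const%:R / Z) ^+ 2.
  by rewrite ler_sqr// nnegrE divr_ge0// ltW.
have -> : e0 ^+ 2 + e1 ^+ 2 + (2 * ((2 * M) ^+ 2 * (8 * D ^+ 3) / Z ^+ 2) +
     2 * (N%:R * (4 * (2 * M) / Q%:R * (2 * D))) ^+ 2) =
   40 * D ^+ 2 * M ^+ 2 * (Q%:R^-1) ^+ 2 + 64 * D ^+ 3 * M ^+ 2 * (Z^-1) ^+ 2 +
   512 * D ^+ 2 * M ^+ 2 * (N%:R / Q%:R) ^+ 2.
  by rewrite /e0 /e1; field; rewrite !lt0r_neq0.
apply: (@le_trans _ _ (3 * (40 * D ^+ 2 * M ^+ 2 * (Z^-1) ^+ 2 + 64 * D ^+ 3 * M ^+ 2 * (Z^-1) ^+ 2 +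
   512 * D ^+ 2 * M ^+ 2 * (term_const%:R / Z) ^+ 2))).
  apply: ler_wpM2l => //; rewrite lerD// ?lerD//; apply: ler_wpM2l => //;
  by rewrite !mulr_ge0// ?exprn_ge0// ltW.
have -> : 3 * (40 * D ^+ 2 * M ^+ 2 * (Z^-1) ^+ 2 + 64 * D ^+ 3 * M ^+ 2 * (Z^-1) ^+ 2 +
   512 * D ^+ 2 * M ^+ 2 * (term_const%:R / Z) ^+ 2) = (error_const - 1) * (M / Z) ^+ 2.
  by rewrite /error_const -/D; field; rewrite lt0r_neq0.
rewrite -[error_const * M / Z]mulrA [leRHS]exprMn; apply: ler_wpM2r; first exact: sqr_ge0.
by have := error_const_ge1; rewrite expr2; nra.
Qed.

End Entropy.

(** * Chaining *)

Section Chaining.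
Context (dm : measure_display) (Omega : measurableType dm) (R : realType).
Variables (Pr : probability Omega R) (n : nat) (xi : 'I_n -> Omega -> R) (s : R).
Hypothesis n_gt0 : (0 < n)%N.
Hypothesis s_gt0 : 0 < s.
Hypothesis xi_indep : mutually_independent Pr xi.
Hypothesis xi_sub : forall i, sub_gaussian Pr s (xi i).

Let np : 0 < n%:R :> R. Proof. by rewrite ltr0n. Qed.

(** Serves a supremum that may fail to be measurable: the integral of a positive part is a supremum
    over the simple functions below it, hence monotone. *)
Lemma integral_le_majorant (f : Omega -> \bar R) (H : Omega -> R) :
  (forall w, 0 <= H w) -> (forall w, (f w <= (H w)%:E)%E) ->
  (\int[Pr]_w f w <= \int[Pr]_w (H w)%:E)%E.
Proof.
move=> H0 fH; rewrite integralE.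
apply: (@le_trans _ _ (\int[Pr]_w (f^\+ w))%E).
  rewrite -[leRHS]adde0; apply: leeD => //; rewrite oppe_le0.
  exact: integral_ge0.
rewrite !ge0_integralTE//.
apply: le_ereal_sup => _ [h hf <-]; exists h => // w.
by apply: le_trans (hf w) _; rewrite funeposE ge_max fH lee_fin H0.
Qed.

Lemma integral_prob_cst (c : R) : (\int[Pr]_w c%:E = c%:E)%E.
Proof.
transitivity (c%:E * Pr setT)%E; first exact: (integral_cst Pr measurableT).
by rewrite probability_setT mule1.
Qed.

Definition pairing (c : 'I_n -> R) w : R := n%:R^-1 * \sum_i xi i w * c i.

Lemma measurable_pairing c : measurable_fun setT (pairing c).
Proof.
case: xi_indep => mxi _; apply: measurable_funM => //; apply: measurable_sum => i.
exact: measurable_funM.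
Qed.

Lemma measurable_expR_pairing l c : measurable_fun setT (fun w => expR (l * pairing c w)).
Proof.
by apply: measurableT_comp => //; apply: measurable_funM => //; exact: measurable_pairing.
Qed.

Lemma integral_expR_pairing (l t : R) (c : 'I_n -> R) :
  \sum_i c i ^+ 2 <= n%:R * t ^+ 2 ->
  (\int[Pr]_w (expR (l * pairing c w))%:E <= (expR ((s * t) ^+ 2 / n%:R * l ^+ 2 / 2))%:E)%E.
Proof.
move=> ct.
have -> : (fun w => (expR (l * pairing c w))%:E) =
    (fun w => (expR (\sum_i (l / n%:R * c i) * xi i w))%:E : \bar R).
  apply: funext => w; congr (expR _)%:E; rewrite /pairing mulrA mulr_sumr.
  by apply: eq_bigr => i _; ring.
apply: le_trans (sub_gaussian_sum _ xi_indep xi_sub) _; rewrite lee_fin ler_expR.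
under eq_bigr do rewrite exprMn.
rewrite -mulr_sumr; apply: ler_wpM2r => //.
have -> : (s * t) ^+ 2 / n%:R * l ^+ 2 = s ^+ 2 * ((l / n%:R) ^+ 2 * (n%:R * t ^+ 2)).
  by field; rewrite lt0r_neq0.
by do 2 (apply: ler_wpM2l; first exact: sqr_ge0).
Qed.

(** The inequality x <= a + e^(x-a) replaces Jensen's inequality and the logarithm: the majorant is
    affine in a sum of exponentials. *)
Lemma max_majorant (D : seq {ffun 'I_n -> R}) (t L : R) : 0 < t -> 1 <= L ->
  (forall c, c \in D -> \sum_i c i ^+ 2 <= n%:R * t ^+ 2) ->
  2 * (size D)%:R <= expR L ->
  exists H : Omega -> R, [/\ measurable_fun setT H, forall w, 0 <= H w,
    forall c w, c \in D -> `|pairing c w| <= H w &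
    (\int[Pr]_w (H w)%:E <= (3 * (s * t / Num.sqrt n%:R) * Num.sqrt L)%:E)%E].
Proof.
move=> t0 L1 Dt DL.
have L0 : 0 < L by lra.
have sn0 : 0 < Num.sqrt n%:R :> R by rewrite sqrtr_gt0.
have sL0 : 0 < Num.sqrt L by rewrite sqrtr_gt0.
pose sg := s * t / Num.sqrt n%:R.
have sg0 : 0 < sg by rewrite divr_gt0// mulr_gt0.
(* With this [l] each exponential moment is at most e^(L/2); then a = 3L/2 gives e^-a 2|D| e^(L/2)
   <= 1. *)
pose l := Num.sqrt L / sg.
have l0 : 0 < l by rewrite divr_gt0.
pose a := L + L / 2.
pose S w := \sum_(c <- D) (expR (l * pairing c w) + expR (- l * pairing c w)).
have S0 w : 0 <= S w by apply: sumr_ge0 => c _; rewrite addr_ge0 ?expR_ge0.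
pose H w := l^-1 * (a + expR (- a) * S w).
have mS : measurable_fun setT S.
  by apply: measurable_sum => c; apply: measurable_funD; exact: measurable_expR_pairing.
have a0 : 0 <= a by rewrite /a; lra.
have sgE : (s * t) ^+ 2 / n%:R * l ^+ 2 / 2 = L / 2.
  have -> : (s * t) ^+ 2 / n%:R = sg ^+ 2.
    by rewrite /sg expr_div_n sqr_sqrtr// ltW.
  rewrite /l [(_ / sg) ^+ 2]expr_div_n (sqr_sqrtr (ltW L0)); field.
  by rewrite lt0r_neq0.
exists H; split.
- apply: measurable_funM => //; apply: measurable_funD => //.
  exact: measurable_funM.
- by move=> w; rewrite /H mulr_ge0 ?invr_ge0 ?(ltW l0)// addr_ge0// mulr_ge0 ?expR_ge0.
- move=> c w cD; rewrite /H ler_pdivlMl//.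
  have -> : l * `|pairing c w| = a + (l * `|pairing c w| - a) by ring.
  rewrite lerD2l; apply: (@le_trans _ _ (expR (l * `|pairing c w| - a))).
    by apply: le_trans (expR_ge1Dx _); rewrite lerDr.
  rewrite addrC expRD ler_pM2l ?expR_gt0//.
  apply: (@le_trans _ _ (expR (l * pairing c w) + expR (- l * pairing c w))).
    case: (ger0P (pairing c w)) => _; first by rewrite lerDl expR_ge0.
    by rewrite mulrN mulNr lerDr expR_ge0.
  rewrite /S (perm_big _ (perm_to_rem cD)) big_cons lerDl.
  by apply: sumr_ge0 => c' _; rewrite addr_ge0 ?expR_ge0.
have IS : (\int[Pr]_w (S w)%:E <= ((size D)%:R * (2 * expR (L / 2)))%:E)%E.
  under eq_integral do rewrite /S -sumEFin.
  rewrite ge0_integral_sum//; try solve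
    [by move=> c; apply/measurable_EFinP; apply: measurable_funD; exact: measurable_expR_pairing
    |by move=> c w _; rewrite lee_fin addr_ge0 ?expR_ge0].
  rewrite big_seq.
  apply: (@le_trans _ _ (\sum_(c <- D | c \in D) (2 * expR (L / 2))%:E)%E).
    apply: lee_sum => c cD; under eq_integral do rewrite EFinD.
    rewrite ge0_integralD//; try solve
      [by apply/measurable_EFinP; exact: measurable_expR_pairing
      |by move=> w _; rewrite lee_fin expR_ge0
      |by apply/measurable_EFinP; exact: measurable_expR_pairing
      |by move=> w _; rewrite lee_fin expR_ge0].
    rewrite mulr_natl mulr2n EFinD -sgE; apply: leeD.
      by apply: integral_expR_pairing; exact: Dt.
    by rewrite -(sqrrN l); apply: integral_expR_pairing; exact: Dt.
  by rewrite -big_seq sumEFin lee_fin big_const_seq count_predT iter_addr_0 -[leLHS]mulr_natl.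
under eq_integral do rewrite /H EFinM EFinD EFinM.
rewrite ge0_integralZl//; try solve
  [by rewrite lee_fin invr_ge0 ltW
  |by move=> w _; rewrite -EFinM -EFinD lee_fin addr_ge0// mulr_ge0 ?expR_ge0
  |by apply/measurable_EFinP; apply: measurable_funD => //; exact: measurable_funM].
rewrite ge0_integralD//; try solve
  [by apply/measurable_EFinP; exact: measurable_funM
  |by move=> w _; rewrite -EFinM lee_fin mulr_ge0 ?expR_ge0].
rewrite integral_prob_cst.
rewrite ge0_integralZl//; try solve
  [by rewrite lee_fin expR_ge0
  |by move=> w _; rewrite lee_fin
  |exact/measurable_EFinP].
apply: (@le_trans _ _ (l^-1%:E * (a%:E + (expR (- a))%:E * ((size D)%:R * (2 * expR (L / 2)))%:E)))%E.
  apply: lee_wpmul2l; first by rewrite lee_fin invr_ge0 ltW.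
  by apply: leeD => //; apply: lee_wpmul2l => //; rewrite lee_fin expR_ge0.
rewrite -!(EFinM, EFinD) lee_fin.
have E1 : expR (- a) * ((size D)%:R * (2 * expR (L / 2))) <= 1.
  have -> : expR (- a) * ((size D)%:R * (2 * expR (L / 2))) = 2 * (size D)%:R * expR (- L).
    have -> : expR (- L) = expR (- a) * expR (L / 2) by rewrite -expRD; congr expR; rewrite /a; lra.
    ring.
  by rewrite expRN ler_pdivrMr ?expR_gt0// mul1r.
apply: (@le_trans _ _ (l^-1 * (3 * L))).
  by apply: ler_wpM2l; [rewrite invr_ge0 ltW|rewrite /a; lra].
have -> : l^-1 * (3 * L) = 3 * (s * t / Num.sqrt n%:R) * Num.sqrt L; last by [].
rewrite -/sg /l invf_div -{2}(sqr_sqrtr (ltW L0)); field.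
by rewrite lt0r_neq0.
Qed.

(** For the last link of the chain, where no net remains: one [H] serves all [z] at once, but
    without the gain 1/sqrt(n). *)
Lemma noise_majorant : exists H : Omega -> R, [/\ measurable_fun setT H, forall w, 0 <= H w,
    forall (z : 'I_n -> R) (u : R) w, 0 < u -> \sum_i z i ^+ 2 <= n%:R * u ^+ 2 ->
      `|pairing z w| <= u * H w &
    (\int[Pr]_w (H w)%:E <= (9 * s)%:E)%E].
Proof.
have mxi := xi_indep.1.
pose T i w := expR (s^-1 * xi i w) + expR (- s^-1 * xi i w).
have T0 i w : 0 <= T i w by rewrite addr_ge0 ?expR_ge0.
have mT i : measurable_fun setT (T i).
  by apply: measurable_funD; apply: measurableT_comp => //; exact: measurable_funM.
pose H w := s / 2 * (1 + 4 * n%:R^-1 * \sum_i T i w).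
(* For x >= 0, by squaring e^(x/2) >= 1 + x/2. *)
have sq x : x ^+ 2 <= 4 * (expR x + expR (- x)) :> R.
  wlog x0 : x / 0 <= x.
    move=> W; have [/W //|/ltW xn] := leP 0 x.
    by have := W (- x); rewrite oppr_ge0 sqrrN opprK addrC; apply.
  have h : 1 + x / 2 <= expR (x / 2) by exact: expR_ge1Dx.
  have E : expR x = expR (x / 2) * expR (x / 2) by rewrite -expRD; congr expR; lra.
  have := expR_ge0 (- x); rewrite E expr2; nra.
exists H; split.
- apply: measurable_funM => //; apply: measurable_funD => //; apply: measurable_funM => //.
  exact: measurable_sum.
- by move=> w; rewrite mulr_ge0 ?(divr_ge0 (ltW s_gt0))// addr_ge0// mulr_ge0 ?sumr_ge0// mulr_ge0 ?invr_ge0.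
- move=> z u w u0 zu; rewrite /pairing normrM (@ger0_norm _ n%:R^-1) ?invr_ge0//.
  (* AM-GM in each coordinate, with weights u/s. *)
  apply: (@le_trans _ _ (n%:R^-1 * \sum_i (s * u / 2 * (4 * T i w) + s / (2 * u) * z i ^+ 2))).
    apply: ler_wpM2l; first by rewrite invr_ge0 ltW.
    apply: le_trans (ler_norm_sum _ _ _) _; apply: ler_sum => i _.
    apply: (@le_trans _ _ (s * u / 2 * (s^-1 * xi i w) ^+ 2 + s / (2 * u) * z i ^+ 2)).
      rewrite -subr_ge0.
      have -> : s * u / 2 * (s^-1 * xi i w) ^+ 2 + s / (2 * u) * z i ^+ 2 - `|xi i w * z i| =
         (2 * s * u)^-1 * (u * `|xi i w| - s * `|z i|) ^+ 2.
        rewrite normrM exprMn sqrrB -(@real_normK _ (xi i w)) ?num_real//.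
        rewrite -(@real_normK _ (z i)) ?num_real//; field.
        by rewrite !lt0r_neq0.
      by rewrite mulr_ge0 ?sqr_ge0// invr_ge0 !mulr_ge0// ltW.
    rewrite lerD2r; apply: ler_wpM2l; first by rewrite !mulr_ge0 ?invr_ge0// ltW.
    by apply: le_trans (sq _) _; rewrite /T mulNr.
  rewrite big_split /= -!mulr_sumr.
  apply: (@le_trans _ _ (n%:R^-1 * (s * u / 2 * (4 * \sum_i T i w) + s / (2 * u) * (n%:R * u ^+ 2)))).
    apply: ler_wpM2l; first by rewrite invr_ge0 ltW.
    rewrite lerD2l; apply: ler_wpM2l => //.
    by rewrite divr_ge0 ?mulr_ge0// ltW.
  rewrite le_eqVlt; apply/orP; left; apply/eqP; rewrite /H; field.
  by rewrite !lt0r_neq0.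
have mTE i : measurable_fun setT (fun w => (T i w)%:E : \bar R) by exact/measurable_EFinP.
have IT i : (\int[Pr]_w (T i w)%:E <= (4%:R : R)%:E)%E.
  under eq_integral do rewrite /T EFinD.
  rewrite ge0_integralD//; try solve
    [by apply/measurable_EFinP; apply: measurableT_comp => //; exact: measurable_funM
    |by move=> w _; rewrite lee_fin expR_ge0
    |by apply/measurable_EFinP; apply: measurableT_comp => //; exact: measurable_funM
    |by move=> w _; rewrite lee_fin expR_ge0].
  have e2 : expR (s ^+ 2 * s^-1 ^+ 2 / 2) <= 2.
    have -> : s ^+ 2 * s^-1 ^+ 2 / 2 = 2^-1 by field; rewrite lt0r_neq0.
    have h : 2^-1 <= expR (- 2^-1) :> R by apply: le_trans (expR_ge1Dx _); lra.
    by rewrite -[2^-1]opprK expRN -[leRHS]invrK lef_pV2 ?posrE ?expR_gt0 ?invr_gt0.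
  have -> : 4%:R = 2 + 2 :> R by rewrite -natrD.
  rewrite EFinD; apply: leeD.
    by apply: le_trans (xi_sub i s^-1) _; rewrite lee_fin.
  by apply: le_trans (xi_sub i (- s^-1)) _; rewrite lee_fin sqrrN.
have HE w : ((H w)%:E = (s / 2)%:E * (1%:E + (4 * n%:R^-1)%:E * \sum_i (T i w)%:E))%E.
  by rewrite sumEFin.
under eq_integral do rewrite HE.
have mST : measurable_fun setT (fun w => \sum_i (T i w)%:E : \bar R)%E by exact: emeasurable_sum.
have ST0 w : (0 <= \sum_i (T i w)%:E :> \bar R)%E by apply: sume_ge0 => i _; rewrite lee_fin.
have nV0 : (0 <= (4 * n%:R^-1 : R)%:E)%E by rewrite lee_fin mulr_ge0// invr_ge0 ltW.
rewrite ge0_integralZl//; try solve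
  [by rewrite lee_fin divr_ge0// ltW
  |by move=> w _; rewrite adde_ge0// ?mule_ge0// lee_fin
  |by apply: emeasurable_funD => //; apply: emeasurable_funM].
rewrite ge0_integralD//; try solve
  [by apply: emeasurable_funM
  |by move=> w _; rewrite mule_ge0
  |by move=> w _; rewrite lee_fin].
rewrite integral_prob_cst.
rewrite ge0_integralZl// ge0_integral_sum//; last by move=> i w _; rewrite lee_fin.
apply: (@le_trans _ _ ((s / 2)%:E * (1%:E + (4 * n%:R^-1)%:E * (\sum_(i < n) (4%:R : R)%:E))))%E.
  apply: lee_wpmul2l; first by rewrite lee_fin divr_ge0// ltW.
  by apply: leeD => //; apply: lee_wpmul2l => //; apply: lee_sum.
rewrite sumEFin sumr_const card_ord -!(EFinM, EFinD) lee_fin.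
have -> : 4 * n%:R^-1 * (4%:R *+ n) = 16 :> R.
  by rewrite -[4%:R *+ n]mulr_natr; field; rewrite lt0r_neq0.
by have := s_gt0; lra.
Qed.

Lemma chaining_majorant (G : set ('I_n -> R)) (B : nat -> seq {ffun 'I_n -> R})
    (v L : nat -> R) (J : nat) :
  B 0%N = [:: 0] -> (forall j, 0 < v j) -> (forall j, v j.+1 <= v j) ->
  (forall j, (j < J)%N -> 1 <= L j) ->
  (forall g j, (j <= J)%N -> G g -> exists2 c, c \in B j & \sum_i (g i - c i) ^+ 2 <= n%:R * v j ^+ 2) ->
  (forall j, (j < J)%N -> 2 * (size (B j.+1) * size (B j))%:R <= expR (L j)) ->
  exists H : Omega -> R, [/\ measurable_fun setT H, forall w, 0 <= H w,
    forall g w, G g -> `|pairing g w| <= H w &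
    (\int[Pr]_w (H w)%:E <= (\sum_(j < J) 3 * (s * (2 * v j) / Num.sqrt n%:R) * Num.sqrt (L j) +
       9 * s * v J)%:E)%E].
Proof.
move=> B0 v0 vd L1 cov Bsz.
have pairD (c c' : 'I_n -> R) w : pairing c w = pairing (fun i => c i - c' i) w + pairing c' w.
  rewrite /pairing -mulrDr -big_split; congr (_ * _); apply: eq_bigr => i _ /=.
  by rewrite -mulrDr subrK.
(* The invariant covers every net point within [v K] of some member of [G], so no chain has to be
   chosen for each member. *)
have claim K : (K <= J)%N -> exists H : Omega -> R, [/\ measurable_fun setT H, forall w, 0 <= H w,
    forall g c w, G g -> c \in B K -> \sum_i (g i - c i) ^+ 2 <= n%:R * v K ^+ 2 ->
      `|pairing c w| <= H w &
    (\int[Pr]_w (H w)%:E <= (\sum_(j < K) 3 * (s * (2 * v j) / Num.sqrt n%:R) * Num.sqrt (L j))%:E)%E].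
  elim: K => [_|K IH KJ].
    exists (fun=> 0); split=> //.
    - move=> g c w _; rewrite B0 inE => /eqP -> _.
      by rewrite /pairing big1 ?mulr0 ?normr0// => i _; rewrite ffunE mulr0.
    - by rewrite big_ord0 integral0.
  have [H [mH H0 HH HI]] := IH (ltnW KJ).
  (* Net points of two consecutive levels near the same member of [G] are at distance at most
     [2 * v K], as the radii decrease. *)
  pose D := [seq x <- [seq c - c' | c <- B K.+1, c' <- B K] |
     \sum_i (x : {ffun 'I_n -> R}) i ^+ 2 <= n%:R * (2 * v K) ^+ 2].
  have [||c|| H' [mH' H'0 HH' HI']] := @max_majorant D (2 * v K) (L K).
  - by rewrite mulr_gt0.
  - exact: L1.
  - by rewrite mem_filter => /andP[].
  - apply: le_trans (Bsz K KJ); rewrite ler_pM2l// ler_nat size_filter.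
    by apply: leq_trans (count_size _ _) _; rewrite size_allpairs.
  exists (fun w => H' w + H w); split.
  - exact: measurable_funD.
  - by move=> w; rewrite addr_ge0.
  - move=> g c w Gg cB gc; have [c' c'B gc'] := cov g K (ltnW KJ) Gg.
    rewrite (pairD c c') ; apply: le_trans (ler_normD _ _) _; apply: lerD; last exact: HH gc'.
    have -> : pairing (fun i => c i - c' i) = pairing (c - c').
      by congr pairing; apply: funext => i; rewrite !ffunE.
    apply: HH'; rewrite mem_filter; apply/andP; split; last first.
      by apply/allpairsP; exists (c, c').
    apply: (@le_trans _ _ (\sum_i (2 * (g i - c i) ^+ 2 + 2 * (g i - c' i) ^+ 2))).
      apply: ler_sum => i _; rewrite !ffunE.
      by have := sqr_ge0 (g i - c i + (g i - c' i)); rewrite !expr2; nra.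
    rewrite big_split /= -!mulr_sumr.
    have vv : v K.+1 ^+ 2 <= v K ^+ 2 by rewrite ler_sqr ?nnegrE ?(ltW (v0 _))// vd.
    have := ler_wpM2l (ltW np) vv; rewrite exprMn; lra.
  - under eq_integral do rewrite EFinD.
    rewrite ge0_integralD//; try solve
      [exact/measurable_EFinP
      |by move=> w _; rewrite lee_fin
      |exact/measurable_EFinP
      |by move=> w _; rewrite lee_fin].
    rewrite addeC big_ord_recr /= [X in (_ <= X)%E]EFinD; apply: leeD; [exact: HI|exact: HI'].
have [H [mH H0 HH HI]] := claim J (leqnn J).
have [H' [mH' H'0 HH' HI']] := noise_majorant.
exists (fun w => H w + v J * H' w); split.
- by apply: measurable_funD => //; exact: measurable_funM.
- by move=> w; rewrite addr_ge0// mulr_ge0// ltW.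
- move=> g w Gg; have [c cB gc] := cov g J (leqnn J) Gg.
  rewrite (pairD g c) addrC; apply: le_trans (ler_normD _ _) _; apply: lerD; first exact: HH gc.
  exact: HH'.
under eq_integral do rewrite EFinD EFinM.
rewrite ge0_integralD//; try solve
  [by apply/measurable_EFinP; exact: measurable_funM
  |by move=> w _; rewrite -EFinM lee_fin mulr_ge0// ltW
  |exact/measurable_EFinP
  |by move=> w _; rewrite lee_fin].
rewrite ge0_integralZl//; try solve
  [by rewrite lee_fin ltW
  |by move=> w _; rewrite lee_fin
  |exact/measurable_EFinP].
rewrite [X in (_ <= X)%E]EFinD; apply: leeD => //.
rewrite [X in (_ <= X)%E](_ : _ = (v J)%:E * (9 * s)%:E)%E; last by rewrite -EFinM mulrC.
by apply: lee_wpmul2l => //; rewrite lee_fin ltW.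
Qed.

End Chaining.

(** * Local complexity *)

Section Scales.
Variables (R : realType) (d : nat).

(** [y] is the real scale at which the cover radius C M/y^(d+3) equals [delta]; delta y^d is the
    leading chaining term. *)
Lemma root_scale (C M delta : R) : 1 <= C -> 0 < delta -> delta <= M ->
  exists y : R, [/\ 1 <= y, y ^+ (d + 3) = C * M / delta &
    delta * y ^+ d <= C * (delta `^ (3 / (d%:R + 3)) * M `^ (d%:R / (d%:R + 3)))].
Proof.
move=> C1 d0 dM.
have C0 : 0 < C by lra.
have M0 : 0 < M by lra.
have D0 : 0 < d%:R + 3 :> R by have := ler0n R d; lra.
have Z1 : 1 <= C * M / delta.
  rewrite ler_pdivlMr// mul1r; apply: le_trans dM _.
  by rewrite -[leLHS]mul1r ler_wpM2r// ltW.
have y0 : 0 <= (C * M / delta) `^ (d%:R + 3)^-1 by exact: powR_ge0.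
exists ((C * M / delta) `^ (d%:R + 3)^-1); split.
- by have := @ler_powR _ _ Z1 0 (d%:R + 3)^-1; rewrite powRr0; apply; rewrite invr_ge0 ltW.
- rewrite -powR_mulrn// -powRrM natrD mulVf ?lt0r_neq0// powRr1//.
  by apply: le_trans Z1.
rewrite -powR_mulrn// -powRrM [_^-1 * _]mulrC.
set al := d%:R / _; set be := 3 / _.
have E1 : delta = delta `^ be * delta `^ al.
  rewrite -powRD; last by rewrite lt0r_neq0// implybT.
  by rewrite /be /al -mulrDl addrC mulfV ?lt0r_neq0// powRr1// ltW.
have Z0 : 0 <= C * M / delta by apply: le_trans Z1.
have E2 : delta `^ al * (C * M / delta) `^ al = C `^ al * M `^ al.
  rewrite -powRM// ?(ltW d0)// -powRM ?(ltW C0) ?(ltW M0)//; congr (_ `^ _).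
  by rewrite mulrC divfK// lt0r_neq0.
have Ca : C `^ al <= C.
  rewrite -[leRHS](powRr1 (ltW C0)); apply: ler_powR => //.
  by rewrite /al ler_pdivrMr// mul1r; lra.
rewrite [X in X * _]E1 -mulrA E2.
have -> : C * (delta `^ be * M `^ al) = delta `^ be * (C * M `^ al) by ring.
by apply: ler_wpM2l; [exact: powR_ge0|apply: ler_wpM2r; [exact: powR_ge0|]].
Qed.

Lemma nat_scale (y : R) : 1 <= y -> exists2 rho : nat, (0 < rho)%N & y <= rho%:R <= 2 * y.
Proof.
move=> y1; have y0 : 0 <= y by lra.
have /andP[h1 h2] := truncn_itv y0.
exists (Num.truncn y).+1 => //; rewrite (ltW h2) /= -[(_).+1%:R]natr1; lra.
Qed.

Lemma sum_half_le2 (J : nat) : \sum_(j < J) (2^-1 : R) ^+ j <= 2.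
Proof.
suff -> : \sum_(j < J) (2^-1 : R) ^+ j = 2 - 2 * 2^-1 ^+ J.
  by rewrite lerBlDr lerDl mulr_ge0// exprn_ge0// invr_ge0.
elim: J => [|J IH]; first by rewrite big_ord0 expr0; lra.
by rewrite big_ord_recr /= IH exprS; lra.
Qed.

Lemma ln2_ge : 2^-1 <= ln 2 :> R.
Proof.
rewrite -(expRK 2^-1) ler_ln ?posrE ?expR_gt0//.
have h : 2^-1 <= expR (- 2^-1) :> R by apply: le_trans (expR_ge1Dx _); lra.
by rewrite -[2^-1]opprK expRN -[leRHS]invrK lef_pV2 ?posrE ?expR_gt0 ?invr_gt0.
Qed.

Lemma leq_pow_mono (E a b : nat) : (a <= b)%N ->
  (a.+1 ^ (E * a ^ (2 * d)) <= b.+1 ^ (E * b ^ (2 * d)))%N.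
Proof.
move=> ab; apply: (@leq_trans (b.+1 ^ (E * a ^ (2 * d)))).
  by case: (E * _)%N => // e; rewrite leq_exp2r.
apply: leq_pexp2l => //; rewrite leq_mul2l; apply/orP; right.
by case: (2 * d)%N => // e; rewrite leq_exp2r.
Qed.

Lemma expR_pow_le (P : nat) (e : nat) (l : R) : (0 < P)%N -> ln P%:R <= l ->
  (P ^ e)%N%:R <= expR (e%:R * l).
Proof.
move=> P0 Pl; rewrite expRM_natl natrX; apply: lerXn2r; rewrite ?nnegrE ?expR_ge0//.
by rewrite -[leLHS]lnK ?posrE ?ltr0n// ler_expR.
Qed.

End Scales.

(** * Summing the chain over dyadic scales *)

Section StarComplexity.
Variables (R : realType) (d : nat) (phi : R -> R).
Hypothesis phi_lip : forall s t, `|phi s - phi t| <= `|s - t|.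
Hypothesis phi0 : phi 0 = 0.

Let C : R := error_const R d.
Let E : nat := entropy_const d.
(** As nM/delta >= 2, a factor 8C inside the logarithm costs at most this factor outside. *)
Let cl : R := 1 + ln (8 * C) / ln 2.

(** 24 collects the 3 of [max_majorant], the doubled radius, a 2 from the decay of the terms and the
    2 of the geometric sum; 18 is the 9 of [noise_majorant] times the 2 in 1 <= 2
    sqrt(ln(nM/delta)). *)
Definition complexity_const : R := C * (24 * 2 ^+ d * Num.sqrt (3 * E%:R * cl) + 18).

Let C1 : 1 <= C. Proof. exact: error_const_ge1. Qed.
Let C0 : 0 < C. Proof. by apply: lt_le_trans C1. Qed.
Let E0 : (0 < E)%N. Proof. by rewrite /E /entropy_const !addnS. Qed.
Let ln20 : 0 < ln 2 :> R.
Proof. by apply: lt_le_trans (ln2_ge R). Qed.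
Let ln8C : 0 <= ln (8 * C).
Proof. by apply: ln_ge0; have := C1; lra. Qed.
Let cl1 : 1 <= cl.
Proof. by rewrite /cl lerDl divr_ge0// ltW. Qed.

Lemma complexity_const_gt0 : 0 < complexity_const.
Proof.
by rewrite /complexity_const mulr_gt0//; apply: ltr_wpDl.
Qed.

(** The scale plus one is at most 2 rho0 2^m <= 8ny, and y <= y^(d+3) = C M/delta. *)
Lemma scale_log_le (M delta y : R) (n rho0 m j : nat) :
  0 < delta -> delta <= M -> (2 <= n)%N -> 1 <= y -> y ^+ (d + 3) = C * M / delta ->
  (0 < rho0)%N -> rho0%:R <= 2 * y -> (2 ^ m <= 2 * n)%N -> (j <= m)%N ->
  ln (rho0 * 2 ^ j).+1%:R <= cl * ln (n%:R * M / delta).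
Proof.
move=> d0 dM n2 y1 yE r0 ry mn jm.
have M0 : 0 < M by lra.
have np : 0 < n%:R :> R by rewrite ltr0n; lia.
have L2 : ln 2 <= ln (n%:R * M / delta).
  rewrite ler_ln ?posrE ?divr_gt0 ?mulr_gt0// ler_pdivlMr//.
  by apply: ler_pM => //; [exact: ltW|rewrite ler_nat].
have Zp : 0 < n%:R * M / delta by rewrite divr_gt0// mulr_gt0.
have Cp : 0 < 8 * C by rewrite mulr_gt0.
apply: (@le_trans _ _ (ln (8 * C * (n%:R * M / delta)))).
  rewrite ler_ln ?posrE ?ltr0n// ?(mulr_gt0 Cp Zp)//.
  apply: (@le_trans _ _ (2 * (rho0 * 2 ^ m)%N%:R)).
    rewrite -natrM ler_nat; have : (2 ^ j <= 2 ^ m)%N by rewrite leq_exp2l.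
    have : (0 < 2 ^ j)%N by rewrite expn_gt0.
    by move: r0; clear; nia.
  rewrite natrM.
  have h1 : (2 ^ m)%N%:R <= 2 * n%:R :> R by rewrite -natrM ler_nat.
  have h2 : rho0%:R * (2 ^ m)%N%:R <= 2 * y * (2 * n%:R) by apply: ler_pM.
  have h3 : y <= C * M / delta by rewrite -yE addnS; apply: ler_eXnr.
  have -> : 8 * C * (n%:R * M / delta) = 8 * n%:R * (C * M / delta) by ring.
  by have := ler_wpM2l (ltW np) h3; nra.
rewrite lnM ?posrE// /cl [leRHS]mulrDl mul1r [leLHS]addrC lerD2l.
by rewrite mulrAC ler_pdivlMr// ler_wpM2l.
Qed.

Lemma star_complexity_le (Fam : forall d' : nat, R -> set ('rV[R]_d' -> R)) :
  (forall M f, Fam d M f -> exists a g,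
     [/\ 0 <= a <= 1, F_sigma_M M g & forall x, f x = a * phi (g x)]) ->
  theorem5_bound complexity_const Fam d.
Proof.
move=> Hstar n M X dm Omega Pr xi s delta n2 M0 XB s0 ind sub d0 dM.
have n0 : (0 < n)%N by apply: leq_trans n2.
have np : 0 < n%:R :> R by rewrite ltr0n.
have [y [y1 yE yb]] := root_scale d C1 d0 dM.
have yp : 0 < y by apply: lt_le_trans y1.
have [rho0 r0 /andP[yr ry]] := nat_scale y1.
(* This depth brings the last radius below delta/n while every scale keeps a logarithm of order at
   most ln(nM/delta). *)
pose m := (trunc_log 2 n).+1.
have /andP[tl1 tl2] := @trunc_log_bounds 2 n isT n0.
have m2n : (2 ^ m <= 2 * n)%N by rewrite expnS leq_mul2l.
have nm : (n <= 2 ^ m)%N by exact: ltnW.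
set Lam := ln (n%:R * M / delta).
have L2 : ln 2 <= Lam.
  rewrite ler_ln ?posrE ?divr_gt0 ?mulr_gt0// ler_pdivlMr//.
  by apply: ler_pM => //; [exact: ltW|rewrite ler_nat].
have L0 : 0 < Lam by apply: lt_le_trans L2.
pose rho j := (rho0 * 2 ^ j)%N.
have rho_gt0 j : (0 < rho j)%N by rewrite muln_gt0 r0 expn_gt0.
have rhoS j : (rho j <= rho j.+1)%N by rewrite leq_mul2l leq_exp2l// leqnSn orbT.
have rhoE j : (rho j)%:R = rho0%:R * 2 ^+ j :> R by rewrite natrM natrX.
have rho_ge j : y * 2 ^+ j <= (rho j)%:R by rewrite rhoE ler_wpM2r// exprn_ge0.
(* Radius [delta] is served by the single net point 0; afterwards indices are shifted, radius j + 1
   belonging to scale [rho j]. *)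
pose v j : R := if j is i.+1 then C * M / (rho i)%:R ^+ (d + 3) else delta.
have CM0 : 0 < C * M by rewrite mulr_gt0.
have rp j : 0 < (rho j)%:R :> R by rewrite ltr0n.
have v0 j : 0 < v j by case: j => [//|j]; rewrite /v divr_gt0// exprn_gt0.
have CME : C * M = delta * y ^+ (d + 3) by rewrite yE [RHS]mulrC divfK// lt0r_neq0.
have vS j : v j.+1 <= v j.
  case: j => [|j] /=.
    rewrite ler_pdivrMr ?exprn_gt0// CME; apply: ler_wpM2l; first exact: ltW.
    apply: lerXn2r; rewrite ?nnegrE ?(ltW yp) ?(ltW (rp _))//.
    by have := rho_ge 0%N; rewrite expr0 mulr1.
  apply: ler_wpM2l; first exact: ltW.
  rewrite lef_pV2 ?posrE ?exprn_gt0//; apply: lerXn2r; rewrite ?nnegrE ?ler0n//.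
  by rewrite ler_nat.
have /choice[A HA] j : exists A : seq {ffun 'I_n -> R},
    (size A <= (rho j).+1 ^ (E * rho j ^ (2 * d)))%N /\
    forall f a, F_sigma_M M f -> 0 <= a <= 1 -> exists2 c, c \in A &
      \sum_i (a * phi (f (X i)) - c i) ^+ 2 <= n%:R * v j.+1 ^+ 2.
  by have [A sA HA] := star_cover phi_lip phi0 (rho_gt0 j) n0 M0 XB; exists A.
pose B j : seq {ffun 'I_n -> R} := if j is i.+1 then A i else [:: 0].
pose G : set ('I_n -> R) := [set g | exists2 f, Fam d M f /\ emp_norm X f <= delta &
   g = (fun i => f (X i))].
(* The 3 accounts for the two nets and the 2 in front, each at most (rho j + 1)^(E rho_j^(2d)). *)
pose L j : R := (3 * E * rho j ^ (2 * d))%N%:R * (cl * Lam).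
have cl0 : 0 < cl by apply: lt_le_trans cl1.
have clL : 2^-1 <= cl * Lam.
  apply: le_trans (ln2_ge R) _; apply: le_trans L2 _.
  by rewrite -[leLHS]mul1r ler_wpM2r// ltW.
have P3 j : (3 <= 3 * E * rho j ^ (2 * d))%N.
  by rewrite -[X in (X <= _)%N]muln1 -mulnA leq_mul2l /= muln_gt0 E0 expn_gt0 rho_gt0.
have L1 j : 1 <= L j.
  apply: (@le_trans _ _ (3 * 2^-1)); first by lra.
  by apply: ler_pM => //; rewrite ?invr_ge0// ler_nat.
have Bsize j : (size (B j) <= (rho j).+1 ^ (E * rho j ^ (2 * d)))%N.
  case: j => [|j]; first by rewrite expn_gt0.
  by apply: leq_trans (HA j).1 _; apply: leq_pow_mono.
have Bsz j : (j < m.+1)%N -> 2 * (size (B j.+1) * size (B j))%:R <= expR (L j).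
  move=> jm.
  have P2 : (2 <= (rho j).+1 ^ (E * rho j ^ (2 * d)))%N.
    apply: (@leq_trans ((rho j).+1 ^ 1)); first by rewrite expn1 ltnS.
    by apply: leq_pexp2l => //; rewrite muln_gt0 E0 expn_gt0 rho_gt0.
  apply: (@le_trans _ _ ((rho j).+1 ^ (3 * E * rho j ^ (2 * d)))%N%:R).
    rewrite -natrM ler_nat -mulnA [X in (_ <= _ ^ X)%N](_ : _ =
      E * rho j ^ (2 * d) + (E * rho j ^ (2 * d) + E * rho j ^ (2 * d)))%N; last first.
      by move: (E * _)%N => e; clear; lia.
    rewrite 2!(expnD _ (E * rho j ^ (2 * d))); apply: leq_mul => //; apply: leq_mul; [exact: (HA j).1|exact: Bsize].
  by apply: expR_pow_le => //; exact: (scale_log_le d0 dM n2 y1 yE r0 ry m2n).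
have cov g j : (j <= m.+1)%N -> G g ->
    exists2 c, c \in B j & \sum_i (g i - c i) ^+ 2 <= n%:R * v j ^+ 2.
  move=> _ [f [Ff fd] ->]; case: j => [|j].
    exists 0; first by rewrite inE.
    under eq_bigr do rewrite ffunE subr0.
    rewrite -ler_pdivrMl//; move: fd; rewrite /emp_norm => fd.
    rewrite -[leLHS]sqr_sqrtr; last first.
      by rewrite mulr_ge0 ?invr_ge0// sumr_ge0// => i _; exact: sqr_ge0.
    by rewrite ler_sqr// nnegrE ?sqrtr_ge0// ltW.
  have [a [g' [a01 Fg E']]] := Hstar _ _ Ff.
  have [c cA Hc] := (HA j).2 g' a Fg a01.
  by exists c => //; under eq_bigr do rewrite E'.
have [H [mH H0 HG HI]] := chaining_majorant n0 s0 ind sub (erefl : B 0%N = [:: 0]) v0 vS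
   (fun j _ => L1 j) cov Bsz.
apply: (@le_trans _ _ (\int[Pr]_w (H w)%:E)%E).
  apply: integral_le_majorant => // w; apply: ge_ereal_sup => _ [f [Ff fd] <-].
  by rewrite lee_fin; apply: (HG (fun i => f (X i))); exists f.
apply: le_trans HI _; rewrite lee_fin.
pose K0 := delta * y ^+ d.
have K00 : 0 < K0 by rewrite mulr_gt0// exprn_gt0.
have sn : 0 < Num.sqrt n%:R :> R by rewrite sqrtr_gt0.
(* Radius times root of the entropy, up to logarithms: proportional to M/rho^3 past the first level.
   Of the resulting decay 8^-j only 2^-j is kept. *)
have vrho j : v j * (rho j)%:R ^+ d <= 2 ^+ d * K0 * 2 * 2^-1 ^+ j.
  case: j => [|j].
    rewrite expr0 mulr1 /v rhoE expr0 mulr1 /K0.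
    have h : rho0%:R ^+ d <= (2 * y) ^+ d.
      by apply: lerXn2r; rewrite ?nnegrE ?ler0n// mulr_ge0// ltW.
    have := ler_wpM2l (ltW d0) h; rewrite exprMn.
    have : 0 <= delta * (2 ^+ d * y ^+ d) by rewrite !mulr_ge0 ?exprn_ge0// ltW.
    by lra.
  have -> : 2 ^+ d * K0 * 2 * 2^-1 ^+ j.+1 = 2 ^+ d * K0 * 2^-1 ^+ j.
    by rewrite exprS; field.
  rewrite /v rhoE exprS [2 * _]mulrC mulrA -rhoE exprMn exprD.
  have -> : C * M / ((rho j)%:R ^+ d * (rho j)%:R ^+ 3) * ((rho j)%:R ^+ d * 2 ^+ d) =
     2 ^+ d * (C * M / (rho j)%:R ^+ 3).
    move: ((rho j)%:R : R) (rp j) => x xp.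
    have xd : x ^+ d != 0 by rewrite lt0r_neq0// exprn_gt0.
    by field; rewrite xd lt0r_neq0.
  rewrite -[leRHS]mulrA; apply: ler_wpM2l; first exact: exprn_ge0.
  rewrite ler_pdivrMr ?exprn_gt0// CME /K0 exprD exprVn -!mulrA; apply: ler_wpM2l; first exact: ltW.
  apply: ler_wpM2l; first by rewrite exprn_ge0// ltW.
  rewrite ler_pdivlMl ?exprn_gt0//.
  have h : (y * 2 ^+ j) ^+ 3 <= (rho j)%:R ^+ 3.
    by apply: lerXn2r; rewrite ?nnegrE ?ler0n// mulr_ge0 ?exprn_ge0// ltW.
  apply: le_trans h; rewrite exprMn mulrC ler_wpM2l ?exprn_ge0 ?(ltW yp)//.
  by rewrite ler_eXnr// exprn_ege1// ler1n.
have sqL j : Num.sqrt (L j) = Num.sqrt (3 * E%:R * cl) * Num.sqrt Lam * (rho j)%:R ^+ d.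
  rewrite /L natrM natrM natrX mulnC exprM.
  have -> : 3 * E%:R * ((rho j)%:R ^+ d) ^+ 2 * (cl * Lam) =
    (3 * E%:R * cl) * Lam * ((rho j)%:R ^+ d) ^+ 2 by ring.
  rewrite sqrtrM; last by rewrite !mulr_ge0// ltW.
  rewrite sqrtrM; last by rewrite !mulr_ge0// ltW.
  by rewrite sqrtr_sqr ger0_norm// exprn_ge0.
set A0 := Num.sqrt (3 * E%:R * cl) in sqL *.
have A00 : 0 <= A0 by exact: sqrtr_ge0.
have SL0 : 0 <= Num.sqrt Lam by exact: sqrtr_ge0.
have term j : 3 * (s * (2 * v j) / Num.sqrt n%:R) * Num.sqrt (L j) <=
   6 * s / Num.sqrt n%:R * A0 * Num.sqrt Lam * (2 ^+ d * K0 * 2) * 2^-1 ^+ j.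
  have -> : 3 * (s * (2 * v j) / Num.sqrt n%:R) * Num.sqrt (L j) =
    6 * s / Num.sqrt n%:R * A0 * Num.sqrt Lam * (v j * (rho j)%:R ^+ d).
    by rewrite sqL; ring.
  rewrite -[leRHS]mulrA; apply: ler_wpM2l; last exact: vrho.
  by rewrite !mulr_ge0 ?invr_ge0// ltW.
have sumle : \sum_(j < m.+1) 3 * (s * (2 * v j) / Num.sqrt n%:R) * Num.sqrt (L j) <=
   24 * s / Num.sqrt n%:R * A0 * Num.sqrt Lam * (2 ^+ d * K0).
  apply: le_trans (ler_sum _ (fun (j : 'I_m.+1) _ => term j)) _.
  rewrite -mulr_sumr.
  have -> : 24 * s / Num.sqrt n%:R * A0 * Num.sqrt Lam * (2 ^+ d * K0) =
    6 * s / Num.sqrt n%:R * A0 * Num.sqrt Lam * (2 ^+ d * K0 * 2) * 2 by ring.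
  apply: ler_wpM2l; last exact: sum_half_le2.
  by rewrite !mulr_ge0 ?invr_ge0 ?exprn_ge0// ltW.
(* Since n <= 2^m the last radius is at most delta/n, which supplies the 1/sqrt(n) absent from
   [noise_majorant]. *)
have vm : v m.+1 <= K0 / Num.sqrt n%:R.
  apply: (@le_trans _ _ (delta / n%:R)).
    rewrite /v ler_pdivrMr ?exprn_gt0// CME -mulrA; apply: ler_wpM2l; first exact: ltW.
    rewrite ler_pdivlMl//.
    apply: (@le_trans _ _ ((y * 2 ^+ m) ^+ (d + 3))); last first.
      by apply: lerXn2r; rewrite ?nnegrE ?ler0n// mulr_ge0 ?exprn_ge0// ltW.
    rewrite exprMn mulrC ler_wpM2l ?exprn_ge0 ?(ltW yp)//.
    apply: (@le_trans _ _ (2 ^+ m)); first by rewrite -natrX ler_nat.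
    by rewrite addnS; apply: ler_eXnr => //; rewrite exprn_ege1// ler1n.
  apply: ler_pM; rewrite ?invr_ge0 ?(ltW d0)//.
    by rewrite /K0 ler_peMr ?(ltW d0)// exprn_ege1.
  rewrite lef_pV2 ?posrE// -[leRHS]sqr_sqrtr ?ler0n// ler_eXnr//.
  by rewrite -[leLHS]sqrtr1 ler_sqrt// ler1n.
(* The noise term has no logarithm; it is absorbed because ln(nM/delta) >= ln 2. *)
have SL : 1 <= 2 * Num.sqrt Lam.
  suff : 2^-1 <= Num.sqrt Lam by lra.
  apply: (@le_trans _ _ (Num.sqrt (2^-1 ^+ 2))); first by rewrite sqrtr_sqr ler_norm.
  rewrite ler_sqrt ?(ltW L0)//; apply: le_trans L2; apply: le_trans (ln2_ge R).
  by rewrite expr2; lra.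
apply: (@le_trans _ _ ((24 * 2 ^+ d * A0 + 18) * (s / Num.sqrt n%:R * Num.sqrt Lam) * K0)).
  have -> : (24 * 2 ^+ d * A0 + 18) * (s / Num.sqrt n%:R * Num.sqrt Lam) * K0 =
     24 * s / Num.sqrt n%:R * A0 * Num.sqrt Lam * (2 ^+ d * K0) +
     9 * s * (K0 / Num.sqrt n%:R) * (2 * Num.sqrt Lam) by ring.
  apply: lerD => //; apply: (@le_trans _ _ (9 * s * (K0 / Num.sqrt n%:R))).
    by apply: ler_wpM2l => //; rewrite mulr_ge0// ltW.
  by rewrite ler_peMr// mulr_ge0 ?(divr_ge0 (ltW K00) (ltW sn))// mulr_ge0 ?(ltW s0).
apply: le_trans (ler_wpM2l _ yb) _.
  rewrite !mulr_ge0 ?invr_ge0// ?(ltW s0)// addr_ge0// !mulr_ge0// exprn_ge0//.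
rewrite le_eqVlt; apply/orP; left; apply/eqP.
by rewrite /complexity_const -/A0; ring.
Qed.

End StarComplexity.

(** Truncation is the projection max(-B, min(c, B)) onto [-B, B]. *)
Lemma clip_lip (R : realType) (B a b : R) : 0 < B ->
  `|(if `|a| <= B then a else Num.sg a * B) - (if `|b| <= B then b else Num.sg b * B)| <= `|a - b|.
Proof.
move=> B0.
have clipE c : (if `|c| <= B then c else Num.sg c * B) = Num.max (- B) (Num.min c B).
  case: (lerP `|c| B).
    by rewrite ler_norml => /andP[h1 h2]; rewrite min_l// max_r.
  case: (ger0P c) => c0 h.
    by rewrite gtr0_sg ?(lt_trans B0 h)// mul1r min_r ?(ltW h)// max_r//; lra.
  by rewrite ltr0_sg// mulN1r min_l ?max_l//; lra.
rewrite !clipE /Num.max /Num.min.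
by do !case: ifPn; rewrite ?ltNge ?negbK => *; rewrite ler_norml;
  case: (ger0P (a - b)) => ?; apply/andP; split; lra.
Qed.

Theorem theorem5 (R : realType) (d : nat) : (1 <= d)%N ->
  (exists C : R, 0 < C /\ theorem5_bound C (@F_sigma_M R) d) /\
  (forall B : R, 0 < B -> exists C : R, 0 < C /\
     theorem5_bound C (fun d' M => star_hull (truncB_class B (@F_sigma_M R d' M))) d).
Proof.
move=> _; split=> [|B B0]; exists (complexity_const R d); split;
  try exact: complexity_const_gt0.
  (* Both classes consist of functions a phi(g): here phi is the identity and a = 1, below phi is
     the truncation. The constant depends on [d] alone, so it is also uniform in [B]. *)
  apply: (@star_complexity_le _ _ id) => // M f Ff.
  by exists 1, f; split=> // [|x]; rewrite ?ler01 ?lexx ?mul1r.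
apply: (@star_complexity_le _ _ (fun t => if `|t| <= B then t else Num.sg t * B)).
- by move=> s t; exact: clip_lip.
- by rewrite normr0 ltW.
by move=> M _ [a [_ [a01 [[g Fg <-] ->]]]]; exists a, g.
Qed.
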